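(* For every integer $N\geq 1$ there is a constant $M>0$, depending only on $N$, such that the following holds. Let $X$ be (the $0$-skeleton of) a CAT(0) cube complex of dimension $N$. Let $\phi:X\times X\to\mathbb{C}$ be a radial function, $\phi=\dot{\phi}\circ d$ with $\dot{\phi}:\mathbb{N}\to\mathbb{C}$, such that the generalised Hankel matrix $$H=\left(\tbinom{N+i-1}{N-1}^{\frac12}\tbinom{N+j-1}{N-1}^{\frac12}\,\mathfrak{d}_2\dot{\phi}(i+j)\right)_{i,j\in\mathbb{N}}$$ belongs to $S_1(\ell_2(\mathbb{N}))$. Then the limits $\lim_{n\to\infty}\dot{\phi}(2n)$ and $\lim_{n\to\infty}\dot{\phi}(2n+1)$ exist, and $\phi$ is a (radial) Schur multiplier on $X$ with $$\|\phi\|_{cb}\leq M\|H\|_{S_1}+|c_+|+|c_-|,$$ where $c_\pm=\frac12\lim_{n\to\infty}\dot{\phi}(2n)\pm\frac12\lim_{n\to\infty}\dot{\phi}(2n+1)$.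
   Context: $\mathbb{N}=\{0,1,2,\dots\}$. For a nonempty set $X$, a function $\phi:X\times X\to\mathbb{C}$ is a Schur multiplier on $X$ if the map $M_\phi:(T_{x,y})_{x,y\in X}\mapsto(\phi(x,y)T_{x,y})_{x,y\in X}$ defines a bounded operator on $\mathcal{B}(\ell_2(X))$, where $T_{x,y}=\langle T\delta_y,\delta_x\rangle$; one writes $\|\phi\|_{cb}=\|M_\phi\|$. A cube complex is a polyhedral complex in which each cell is isometric to a Euclidean cube $[0,1]^n$ and the gluing maps are isometries; its dimension is the maximum of such $n$. CAT(0) cube complexes may be defined as those whose $1$-skeleton is a median graph: a connected graph such that for all vertices $x,y,z$ the set $I(x,y)\cap I(y,z)\cap I(z,x)$ has exactly one element, where $I(x,y)=\{u: d(x,y)=d(x,u)+d(u,y)\}$. The distance $d$ on the vertex set $X$ is the combinatorial (shortest path) distance of the $1$-skeleton. Discrete derivative: $\mathfrak{d}_2\dot{\phi}(n)=\dot{\phi}(n)-\dot{\phi}(n+2)$. $S_1(\ell_2(\mathbb{N}))$ is the space of trace class operators on $\ell_2(\mathbb{N})$ with trace norm $\|\cdot\|_{S_1}$; an infinite matrix belongs to it if it is the matrix, in the canonical basis, of a trace class operator. *)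

(* Defs.v *)
From HB Require Import structures.
From mathcomp Require Import all_boot all_order all_algebra finmap.
From mathcomp Require Import complex.
From mathcomp Require Import all_classical all_reals all_analysis.
From mathcomp Require Import ring lra.
From mathcomp Require summability.
Set Implicit Arguments.
Unset Strict Implicit.
Unset Printing Implicit Defensive.
Import Order.TTheory GRing.Theory Num.Theory.
Import numFieldNormedType.Exports.
Local Open Scope classical_set_scope.
Local Open Scope ring_scope.

Section Graph.
Variables (V : choiceType) (e : rel V).

Definition walk_length (x y : V) : set nat :=
  [set n | exists p : seq V, [/\ path e x p, last x p = y & size p = n]].

Definition connected_graph := forall x y : V, walk_length x y !=set0.

(* The default value 0 is only reached when no walk joins [x] to [y]. *)
Definition dist (x y : V) : nat :=
  xget 0%N [set n | walk_length x y n /\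
                    forall m, walk_length x y m -> (n <= m)%N].

Definition geod_interval (x y : V) : set V :=
  [set u | dist x y = (dist x u + dist u y)%N].

Definition median_graph :=
  connected_graph /\
  forall x y z : V,
    exists! u : V, (geod_interval x y `&` geod_interval y z `&`
                    geod_interval z x) u.

End Graph.

(* Vertices of the cube [0,1]^n. *)
Definition cube (n : nat) := {ffun 'I_n -> bool}.

Definition hamming (n : nat) (u v : cube n) : nat := #|[set i | u i != v i]%SET|.

(* The Hamming-isometric maps between cubes are the vertex maps of the
   isometries of [0,1]^k onto a k-dimensional face of [0,1]^n; for k = n, these
   are the symmetries of the cube. *)
Definition cube_isometry (k n : nat) (h : cube k -> cube n) :=
  forall u v, hamming (h u) (h v) = hamming u v.

(* A cell is recorded by the restriction to vertices of its characteristic map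
   [0,1]^n -> X, so the set of cells is closed under the symmetries of the
   cube.  Characteristic maps are injective, and the intersection of two cells
   is empty or a face of both, along which they are glued isometrically. *)
Record cubeComplex := CubeComplex {
  vertex :> choiceType;
  cell : forall n, (cube n -> vertex) -> Prop;
  cell_inj : forall n (c : cube n -> vertex), cell c -> injective c;
  cell_vertex : forall x : vertex, cell (fun _ : cube 0 => x);
  cell_face : forall k n (h : cube k -> cube n) (c : cube n -> vertex),
    cube_isometry h -> cell c -> cell (c \o h);
  cell_meet : forall m n (b : cube m -> vertex) (c : cube n -> vertex),
    cell b -> cell c -> (exists u v, b u = c v) ->
    exists k (g : cube k -> cube m) (h : cube k -> cube n),
      [/\ cube_isometry g, cube_isometry h, b \o g =1 c \o h &
          forall u v, b u = c v -> exists w, u = g w /\ v = h w]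
}.

Definition skeleton1 (K : cubeComplex) : rel K := fun x y =>
  `[< exists c : cube 1 -> K,
        [/\ cell c, c [ffun=> false] = x & c [ffun=> true] = y] >].
Arguments skeleton1 : clear implicits.

(* The second clause says that the complex is the one determined by its
   1-skeleton, i.e., that no cube is missing: the boundary of a square has a
   median 1-skeleton, but is not CAT(0). *)
Definition CAT0 (K : cubeComplex) :=
  median_graph (skeleton1 K) /\
  forall n (c : cube n -> K), injective c ->
    (forall u v, hamming u v = 1%N -> skeleton1 K (c u) (c v)) -> cell c.

Definition has_dimension (K : cubeComplex) (N : nat) :=
  (exists c : cube N -> K, cell c) /\
  forall n (c : cube n -> K), cell c -> (n <= N)%N.

Definition cabs (R : realType) (z : R[i]) : R := ComplexField.Normc.normc z.

Section L2.
Variables (R : realType) (X : choiceType).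

Definition sqsum (f : X -> R[i]^o) : \bar R :=
  \esum_(x in setT) (cabs (f x) ^+ 2)%:E.

Definition is_l2 : {pred X -> R[i]^o} := [pred f | `[< (sqsum f < +oo)%E >]].

Lemma is_l2_submod : submod_closed is_l2.
Proof.
have cabs2_ge0 z : (0 <= (cabs z ^+ 2)%:E)%E by rewrite lee_fin sqr_ge0.
split=> [|a f g /asboolP ff /asboolP gg]; apply/asboolP.
  rewrite /sqsum esum1 ?ltry// => x _.
  by rewrite /cabs ComplexField.Normc.normc0 expr0n.
pose M := 2 * cabs a ^+ 2; have M0 : 0 <= M by rewrite mulr_ge0 ?sqr_ge0.
have esumZ (k : R) (h : X -> R[i]^o) : 0 <= k ->
    (\esum_(x in setT) (k * cabs (h x) ^+ 2)%:E <= k%:E * sqsum h)%E.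
  move=> k0; apply: ge_ereal_sup => _ [A [finA _] <-].
  rewrite (eq_fsbigr (fun x => k%:E * (cabs (h x) ^+ 2)%:E)%E); last first.
    by move=> x _; rewrite EFinM.
  rewrite -ge0_mule_fsumr; last by move=> i; exact: cabs2_ge0.
  apply: lee_wpmul2l; first by rewrite lee_fin.
  by apply: ereal_sup_ubound; exists A.
have le2 x : ((cabs ((a *: f + g) x) ^+ 2)%:E <=
    (M * cabs (f x) ^+ 2)%:E + (2 * cabs (g x) ^+ 2)%:E)%E.
  rewrite -EFinD lee_fin.
  have cD : cabs ((a *: f + g) x) <= cabs a * cabs (f x) + cabs (g x).
    rewrite /cabs -ComplexField.Normc.normcM.
    exact: (@ler_normD R (Rcomplex R) (a * f x) (g x)).
  have c0 z : 0 <= cabs z by rewrite /cabs; case: z => u v; apply: sqrtr_ge0.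
  apply: le_trans (_ : (cabs a * cabs (f x) + cabs (g x)) ^+ 2 <= _).
    by rewrite lerXn2r ?nnegrE ?addr_ge0 ?mulr_ge0 ?c0.
  rewrite /M -mulrA -exprMn; set u := cabs a * _; set v := cabs _.
  rewrite -subr_ge0 (_ : _ - _ = (u - v) ^+ 2) ?sqr_ge0//.
  by rewrite sqrrD sqrrB !mulr2n !mulrDl !mul1r opprD; ring.
apply: le_lt_trans (_ : (M%:E * sqsum f + 2%:E * sqsum g < +oo)%E); last first.
  by rewrite lte_add_pinfty ?lte_mul_pinfty ?lee_fin ?esum_ge0.
apply: le_trans (leeD (esumZ _ f M0) (esumZ 2 g _)) => //.
rewrite -esumD//; last 2 first.
- by move=> x _; rewrite lee_fin mulr_ge0 ?sqr_ge0.
- by move=> x _; rewrite lee_fin mulr_ge0 ?sqr_ge0.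
exact: le_esum.
Qed.

HB.instance Definition _ := GRing.isSubmodClosed.Build R[i] (X -> R[i]^o) is_l2
  is_l2_submod.

Record l2 := L2 { l2_fun :> X -> R[i]^o; _ : l2_fun \in is_l2 }.

HB.instance Definition _ := [isSub for l2_fun].
HB.instance Definition _ := [Choice of l2 by <:].
HB.instance Definition _ := [SubChoice_isSubLmodule of l2 by <:].

Definition l2norm (f : l2) : R := Num.sqrt (fine (sqsum f)).

(* Linear in the first argument; the sum over [X] is the unconditional one, the
   limit of the sums over finite subsets. *)
Definition inner (f g : l2) : R[i] :=
  summability.sum (fun x => (f x * (g x)^*)%R : R[i]^o).

Lemma delta_subproof (y : X) :
  (fun x => (x == y)%:R : R[i]^o) \in is_l2.
Proof.
apply/asboolP; rewrite /sqsum.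
rewrite (eq_esum (b := fun x => if x \in [set y] then 1%E else 0%E)); last first.
  move=> x _; rewrite in_set1; case: eqP => _.
    by rewrite /cabs mulr1n (ComplexField.Normc.normc1 R) expr1n.
  by rewrite /cabs mulr0n (ComplexField.Normc.normc0 R) expr0n.
by rewrite -esum_mkcond esum_set1 ?lee01// ltry.
Qed.

Definition delta (y : X) : l2 := L2 (delta_subproof y).

Definition opnorm (T : l2 -> l2) : \bar R :=
  ereal_sup [set (l2norm (T f))%:E | f in [set f | l2norm f <= 1]].

Definition bounded_operator (T : l2 -> l2) : Prop :=
  linear T /\ (opnorm T < +oo)%E.

Definition entry (T : l2 -> l2) (x y : X) : R[i] := inner (T (delta y)) (delta x).

Definition is_adjoint (T S : l2 -> l2) :=
  forall f g, inner (T f) g = inner f (S g).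

(* For the order of [R[i]], [0 <= z] says that [z] is real and nonnegative. *)
Definition positive_operator (P : l2 -> l2) :=
  bounded_operator P /\ forall f, 0 <= inner (P f) f.

(* [P] is |T|, the positive square root of the product of the adjoint of [T] and
   [T]. *)
Definition is_abs (T P : l2 -> l2) :=
  positive_operator P /\ exists S, is_adjoint T S /\ P \o P =1 S \o T.

(* The trace of a positive operator. *)
Definition trace (P : l2 -> l2) : \bar R :=
  \esum_(x in setT) (complex.Re (entry P x x))%:E.

(* Every bounded operator has exactly one absolute value, so the default value
   +oo plays no role for them. *)
Definition trace_norm (T : l2 -> l2) : \bar R :=
  xget +oo%E [set trace P | P in is_abs T].

Definition trace_class (T : l2 -> l2) :=
  bounded_operator T /\ (trace_norm T < +oo)%E.

(* [S] is the image of [T] by M_phi. *)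
Definition is_schur_product (phi : X -> X -> R[i]) (T S : l2 -> l2) :=
  forall x y, entry S x y = phi x y * entry T x y.

(* The operator norm of M_phi. *)
Definition cb_norm (phi : X -> X -> R[i]) : \bar R :=
  ereal_sup [set opnorm S | S in
    [set S | bounded_operator S /\
             exists T, [/\ bounded_operator T, (opnorm T <= 1)%E &
                           is_schur_product phi T S]]].

Definition schur_multiplier (phi : X -> X -> R[i]) :=
  (forall T, bounded_operator T ->
     exists S, bounded_operator S /\ is_schur_product phi T S) /\
  (cb_norm phi < +oo)%E.

End L2.

Definition diff2 (R : realType) (f : nat -> R[i]) (n : nat) : R[i] :=
  f n - f (n + 2)%N.

(* Only meant for [1 <= N]: the subtractions are truncated. *)
Definition hankel (R : realType) (N : nat) (f : nat -> R[i]) (i j : nat) : R[i] :=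
  (Num.sqrt ('C((N + i - 1)%N, (N - 1)%N))%:R)%:C%C *
  (Num.sqrt ('C((N + j - 1)%N, (N - 1)%N))%:R)%:C%C * diff2 f (i + j)%N.

(* Main.v *)
Require Import Defs.
From mathcomp Require Import all_boot all_order all_algebra finmap complex.
From mathcomp Require Import all_classical all_reals all_analysis.
From mathcomp Require Import zify ring lra.
From mathcomp Require summability.
Set Implicit Arguments.
Unset Strict Implicit.
Unset Printing Implicit Defensive.
Import Order.TTheory GRing.Theory Num.Theory.
Import numFieldNormedType.Exports.
Local Open Scope classical_set_scope.
Local Open Scope ring_scope.

(** Fix a base vertex [o] and order the vertices by [v <= x] iff [v] lies on a
    geodesic from [o] to [x]; the median of [x], [y], [o] is their meet [m], and
    [d(x,y) = |x| + |y| - 2|m|] with [|x| = d(o,x)].  A vertex [v] covers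
    [q(v) <= N] others, because its lower covers span a cube.  Splitting the
    vertices below [m] along a lower cover of [m] gives, by induction, both
    [\sum_(v <= m) X^(|m|-|v|) (1-X)^q(v) = 1] and the bound
    ['C(N+i-1, i)] on the number of [v <= m] with [|m|-|v| = i].
    With [h(n) = phi(n) - phi(n+2)], the identity says that a signed combination,
    over the [v <= m] and [s < N], of the values [h(i+j)] with
    [i = |x|-|v|+s] and [j = |y|-|v|+s] telescopes to
    [phi(d(x,y)) - phi(|x|+|y|+2)]; as [v <= m] means [v <= x] and [v <= y], a
    decomposition [h(i+j) = \sum_l a_l(i) b_l(j)] turns this into a Gram kernel,
    the counting bound being what the weights of the Hankel matrix compensate.
    The remaining [phi(|x|+|y|+2) - lim] is handled in the same way by a ray
    attached at [o].
    The decomposition comes from Gram-Schmidt orthogonalisation of the basis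
    vectors for the form [<|H|f, g>]: if [g_k] is the resulting family, then
    [H e_i = \sum_k <e_i, |H|g_k> H g_k], [||H g_k|| = || |H|g_k ||], and by
    Bessel's inequality [\sum_k || |H|g_k ||^2] is at most the trace of [|H|]. *)

(** * Distance and medians *)

Section Distance.
Variables (V : choiceType) (e : rel V).
Hypotheses (e_sym : symmetric e) (e_irr : irreflexive e)
  (e_con : connected_graph e).
Local Notation d := (dist e).

(** Connectedness makes the set of walk lengths nonempty, so it has a minimum and [xget] does not
    return its default. *)
Lemma dist_spec x y : walk_length e x y (d x y) /\
  forall m, walk_length e x y m -> (d x y <= m)%N.
Proof.
apply: (@xgetPex _ 0%N [set n | walk_length e x y n /\
  forall m, walk_length e x y m -> (n <= m)%N]).
have ex : exists n, `[< walk_length e x y n >].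
  by have [n wn] := e_con x y; exists n; apply/asboolP.
case: (ex_minnP ex) => n /asboolP wn nmin; exists n; split => // m wm.
by apply: nmin; apply/asboolP.
Qed.

Lemma distxx x : d x x = 0%N.
Proof.
have [_ h] := dist_spec x x.
by apply/eqP; rewrite -leqn0; apply: h; exists [::].
Qed.

Lemma dist_eq0 x y : d x y = 0%N -> x = y.
Proof.
by have [[p [_ <- <-]] _] := dist_spec x y => /eqP; rewrite size_eq0 => /eqP ->.
Qed.

Lemma dist_triangle x y z : (d x z <= d x y + d y z)%N.
Proof.
have [[p [pp pl ps]] _] := dist_spec x y.
have [[q [qp ql qs]] _] := dist_spec y z.
have [_ h] := dist_spec x z.
apply: h; exists (p ++ q); split.
- by rewrite cat_path pp pl qp.
- by rewrite last_cat pl.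
- by rewrite size_cat ps qs.
Qed.

Lemma dist_sym x y : d x y = d y x.
Proof.
suff h u v : (d u v <= d v u)%N by apply/eqP; rewrite eqn_leq !h.
have [[p [pp pl ps]] _] := dist_spec v u.
have [_ h] := dist_spec u v.
apply: h; exists (rev (belast v p)); split.
- by rewrite -pl rev_path (eq_path (e' := e)) // => a b; rewrite e_sym.
- by case: p {pp ps} pl => [|a p] //= _; rewrite rev_cons last_rcons.
- by rewrite size_rev size_belast.
Qed.

Lemma dist_adj x y : e x y -> d x y = 1%N.
Proof.
move=> exy; apply/eqP; rewrite eqn_leq; apply/andP; split.
  have [_ h] := dist_spec x y.
  by apply: h; exists [:: y]; split=> //=; rewrite exy.
rewrite lt0n; apply/eqP => /dist_eq0 xy.
by rewrite xy e_irr in exy.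
Qed.

Lemma dist_step x y n : d x y = n.+1 -> exists2 z, e x z & d z y = n.
Proof.
move=> dn; have [[p [pp pl ps]] _] := dist_spec x y.
case: p pp pl ps => [|z p] /=; first by rewrite dn.
move=> /andP[exz zp] pl ps; exists z => //.
have [_ h] := dist_spec z y.
have h1 : (d z y <= n)%N.
  by apply: h; exists p; split => //; move: ps; rewrite dn => -[].
have := dist_triangle x z y.
by rewrite (dist_adj exz) dn; lia.
Qed.

Lemma dist1 x y : d x y = 1%N -> e x y.
Proof. by move=> /dist_step[z exz /dist_eq0 <-]. Qed.

End Distance.

(** * The order rooted at [o] and its meets *)

Section Median.
Variables (V : choiceType) (e : rel V).
Hypotheses (e_sym : symmetric e) (e_irr : irreflexive e)
  (e_med : median_graph e).
Variable o : V.
Local Notation d := (dist e).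
Local Notation rk := (dist e o).

Let e_con : connected_graph e. Proof. by case: e_med. Qed.
Let dxx := distxx e_con.
Let deq0 := dist_eq0 e_con.
Let dtri := dist_triangle e_con.
Let dsym := dist_sym e_sym e_con.

Definition below (v x : V) : bool := rk x == (rk v + d v x)%N.

Definition lcover (b m : V) : bool := below b m && (d b m == 1%N).

Lemma belowxx x : below x x.
Proof. by rewrite /below dxx addn0. Qed.

Lemma below0 x : below o x.
Proof. by rewrite /below dxx add0n. Qed.

Lemma below_le v x : below v x -> (rk v <= rk x)%N.
Proof. by move=> /eqP ->; rewrite leq_addr. Qed.

Lemma below_trans x y z : below x y -> below y z -> below x z.
Proof.
move=> /eqP xy /eqP yz; apply/eqP.
by have := dtri x y z; have := dtri o x z; lia.
Qed.

Lemma below_anti x y : below x y -> below y x -> x = y.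
Proof.
by move=> /eqP xy /eqP yx; apply: deq0; lia.
Qed.

(** The median [m] of [x], [y], [o] is the meet. If [v] is below [x] and [y], the median [w] of [x],
    [y], [v] lies above [v] and on geodesics from [o] to [x] and to [y], so uniqueness gives
    [w = m]. *)
Lemma meet_exists x y : exists m,
  [/\ forall v, below v m = below v x && below v y &
      (d x y + (rk m).*2 = rk x + rk y)%N].
Proof.
have [m [[[mxy myo] mox] mU]] := e_med.2 x y o.
move: mxy myo mox; rewrite /geod_interval /=.
rewrite (dsym y o) (dsym m o) (dsym m y) => mxy myo mox.
rewrite (dsym m x) in mox.
have mx : below m x by apply/eqP; rewrite mox (dsym m x).
have my : below m y by apply/eqP; rewrite myo addnC (dsym m y).
exists m; split; last by lia.
move=> v; apply/idP/andP => [vm|[/eqP vx /eqP vy]].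
  by split; apply: below_trans vm _.
have [w [[[wxy wyv] wvx] _]] := e_med.2 x y v.
move: wxy wyv wvx; rewrite /geod_interval /=.
rewrite (dsym w y) (dsym w x) (dsym y v) (dsym w v) => wxy wyv wvx.
have T1 := dtri o v w; have T2 := dtri o w x; have T3 := dtri o w y.
rewrite (dsym w x) in T2; rewrite (dsym w y) in T3.
have E1 : rk w = (rk v + d v w)%N by lia.
suff -> : m = w by apply/eqP.
apply: mU; split; [split|]; rewrite /geod_interval /=.
- by rewrite (dsym w y).
- by rewrite (dsym y o) (dsym w o); lia.
- by rewrite (dsym w x); lia.
Qed.

Definition meet x y := projT1 (cid (meet_exists x y)).

Lemma below_meet v x y : below v (meet x y) = below v x && below v y.
Proof. by rewrite /meet; case: (cid _) => m []. Qed.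

Lemma dist_meet x y : (d x y + (rk (meet x y)).*2 = rk x + rk y)%N.
Proof. by rewrite /meet; case: (cid _) => m []. Qed.

Lemma lcover_below b m : lcover b m -> below b m.
Proof. by case/andP. Qed.

Lemma lcover_rank b m : lcover b m -> rk m = (rk b).+1.
Proof. by move=> /andP[/eqP -> /eqP ->]; rewrite addn1. Qed.

Lemma below_lcover v m : below v m -> v != m ->
  exists2 b, lcover b m & below v b.
Proof.
move=> /eqP vm vNm.
have : d m v != 0%N by apply: contra vNm => /eqP/deq0 ->.
case E : (d m v) => [//|n] _.
have [b emb dbv] := dist_step e_irr e_con E.
have db := dist_adj e_irr e_con emb.
have T1 := dtri o b m; have T2 := dtri o v b.
rewrite dsym in E; rewrite dsym in dbv; rewrite dsym in db.
by exists b; [apply/andP; split; apply/eqP => //|apply/eqP]; lia.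
Qed.

(** The two covers have equal rank, so [d b c] is even by [dist_meet]; being nonzero and at most 2
    it equals 2, which puts the meet one rank below [b]. *)
Lemma meet_lcover m b c : lcover b m -> lcover c m -> b != c ->
  lcover (meet b c) b.
Proof.
move=> bm cm bNc.
have := lcover_rank bm; have := lcover_rank cm => rc rb.
have D := dist_meet b c.
have T := dtri b m c; rewrite (dsym m c) in T.
have /andP[_ /eqP db] := bm; have /andP[_ /eqP dc] := cm.
have d0 : d b c <> 0%N by move=> /deq0 bc; rewrite bc eqxx in bNc.
have lb : below (meet b c) b.
  by have := belowxx (meet b c); rewrite below_meet => /andP[].
apply/andP; split => //; apply/eqP; move: lb => /eqP; lia.
Qed.

(** A median graph contains no [K_{2,3}]: for distinct [c], [c'] with the same meet [u], both [u]
    and [m] would be medians of [b], [c], [c'], although their ranks differ. *)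
Lemma meet_lcover_inj m b c c' : lcover b m -> lcover c m -> lcover c' m ->
  b != c -> b != c' -> meet b c = meet b c' -> c = c'.
Proof.
move=> bm cm c'm bc bc' E; apply/eqP; apply: contraT => cc'.
have cb : c != b by rewrite eq_sym.
have c'b : c' != b by rewrite eq_sym.
have dc x : lcover x m -> d x m = 1%N by move=> /andP[_ /eqP].
have d2 x y : lcover x m -> lcover y m -> x != y -> d x y = 2%N.
  move=> xm ym xy; have L := meet_lcover xm ym xy.
  have := dist_meet x y; have := lcover_rank L; have := lcover_rank xm.
  by have := lcover_rank ym; clear; lia.
pose u := meet b c.
have comm x y : meet x y = meet y x.
  by apply: below_anti; rewrite below_meet -andbC -below_meet belowxx.
have ub : d u b = 1%N by have /andP[_ /eqP] := meet_lcover bm cm bc.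
have uc : d u c = 1%N.
  by rewrite /u comm; have /andP[_ /eqP] := meet_lcover cm bm cb.
have uc' : d u c' = 1%N.
  by rewrite /u E comm; have /andP[_ /eqP] := meet_lcover c'm bm c'b.
have [w [_ wU]] := e_med.2 b c c'.
have wm : w = m.
  apply: wU; split; [split|]; rewrite /geod_interval /= !(d2 b c, d2 c c', d2 c' b) //
    !(dsym m) !dc //.
have wu : w = u.
  apply: wU; split; [split|]; rewrite /geod_interval /=
    !(ub, uc, uc', dsym b u, dsym c u, dsym c' u) !(d2 b c, d2 c c', d2 c' b) //.
have := lcover_rank (meet_lcover bm cm bc); rewrite -/u -wu wm.
by have := lcover_rank bm; clear; lia.
Qed.

(** Induction step for what follows: a family of lower covers of [m] is traded for one, shorter by
    one, of lower covers of [b]. *)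
Lemma lcover_meets b B m : uniq (b :: B) -> all (lcover^~ m) (b :: B) ->
  uniq (map (meet b) B) /\ all (lcover^~ b) (map (meet b) B).
Proof.
rewrite /= => /andP[bB uB] /andP[bm /allP Bm].
have bN c : c \in B -> b != c by move=> cB; apply: contraNneq bB => ->.
split; last first.
  by apply/allP => _ /mapP[c cB ->]; apply: meet_lcover bm (Bm _ cB) (bN _ cB).
rewrite map_inj_in_uniq // => c c' cB c'B.
exact: (meet_lcover_inj bm (Bm _ cB) (Bm _ c'B) (bN _ cB) (bN _ c'B)).
Qed.

(** By induction, the infimum of [b :: B] is that of the lower covers [meet b c] of [b]; each member
    of the family costs one rank. *)
Lemma lcover_inf B m : uniq B -> all (lcover^~ m) B -> exists u,
  (forall v, below v u = below v m && all (below v) B) /\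
  (rk u + size B = rk m)%N.
Proof.
have [n] := ubnP (size B).
elim: n B m => // n IH [|b B] m sB uB Bm.
  by exists m; split => [v|]; rewrite ?andbT ?addn0.
have [uB' Bm'] := lcover_meets uB Bm.
have [|u [uP ur]] := IH _ b _ uB' Bm'; first by rewrite size_map.
have /= /andP[bm _] := Bm.
exists u; split => [v|]; last first.
  by rewrite /= (lcover_rank bm) -ur size_map addnS.
rewrite uP all_map /=; case vb: (below v b) => /=; last by rewrite andbF.
rewrite (below_trans vb (lcover_below bm)) /=.
by apply: eq_all => c /=; rewrite below_meet vb.
Qed.

End Median.

(** * CAT(0) cube complexes *)

Section Skeleton.
Variable K : cubeComplex.
Local Notation e := (skeleton1 K).

Lemma skeleton1_sym : symmetric e.
Proof.
suff h x y : e x y -> e y x by move=> x y; apply/idP/idP; apply: h.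
move=> /asboolP[c [cc cx cy]].
pose f (u : cube 1) : cube 1 := [ffun i => ~~ u i].
have fi : cube_isometry f.
  move=> u v; rewrite /hamming; apply: eq_card => i.
  by rewrite !inE !ffunE (inj_eq negb_inj).
apply/asboolP; exists (c \o f); split; first exact: cell_face.
- by rewrite /= -cy; congr c; apply/ffunP => i; rewrite !ffunE.
- by rewrite /= -cx; congr c; apply/ffunP => i; rewrite !ffunE.
Qed.

Lemma skeleton1_irr : irreflexive e.
Proof.
move=> x; apply/negP => /asboolP[c [cc <- /(cell_inj cc) /ffunP /(_ ord0)]].
by rewrite !ffunE.
Qed.

Hypothesis K_CAT0 : CAT0 K.
Variable o : K.
Local Notation rk := (dist e o).
Local Notation below := (below e o).
Local Notation lcover := (lcover e o).

Let e_med : median_graph e. Proof. by case: K_CAT0. Qed.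
Let e_con : connected_graph e. Proof. by case: e_med. Qed.
Let e_sym := skeleton1_sym.
Let e_irr := skeleton1_irr.

(* The meets of the subfamilies of [B] are the vertices of a cube. *)
Lemma lcover_cell B m : uniq B -> all (lcover^~ m) B ->
  exists c : cube (size B) -> K, cell c.
Proof.
move=> uB Bm; set q := size B; pose b (i : 'I_q) := nth m B i.
pose s (S : {set 'I_q}) := map b (enum S).
have bm i : lcover (b i) m by apply: (allP Bm); rewrite mem_nth.
have us S : uniq (s S).
  rewrite map_inj_uniq ?enum_uniq // => i j /eqP.
  by rewrite /b nth_uniq // => /eqP /val_inj.
have sm S : all (lcover^~ m) (s S).
  by apply/allP => _ /mapP[i _ ->].
have [g gP] : {g : {set 'I_q} -> K & forall S,
    (forall v, below v (g S) = below v m && all (below v) (s S)) /\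
    (rk (g S) + #|S| = rk m)%N}.
  apply: (@choice _ _ (fun S u => (forall v, below v u = below v m && all (below v) (s S)) /\
    (rk u + #|S| = rk m)%N)) => S.
  have [u [uP ur]] := lcover_inf e_sym e_med (us S) (sm S).
  by exists u; split => //; rewrite -ur size_map -cardE.
have gb (S : {set 'I_q}) i : i \in S -> below (g S) (b i).
  move=> iS; have := (gP S).1 (g S); rewrite (belowxx e_med) // => /esym/andP[_ /allP]; apply.
  by apply: map_f; rewrite mem_enum.
have gm S : below (g S) m.
  by have := (gP S).1 (g S); rewrite (belowxx e_med) // => /esym/andP[].
have gU S v i : below v (g (i |: S)) = below v (g S) && below v (b i).
  rewrite !(gP _).1 -andbA; congr andb; apply/allP/andP => [h|[/allP h hi]].
    split; last by apply: h; apply: map_f; rewrite mem_enum setU11.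
    apply/allP => _ /mapP[j jS ->]; apply: h; apply: map_f.
    by move: jS; rewrite !mem_enum => jS; rewrite setU1r.
  move=> _ /mapP[j jS ->]; move: jS; rewrite mem_enum => /setU1P[-> //|jS].
  by apply: h; apply: map_f; rewrite mem_enum.
have gr (S : {set 'I_q}) i : i \notin S -> rk (g S) = (rk (g (i |: S))).+1.
  by move=> iS; have := (gP S).2; have := (gP (i |: S)).2; rewrite cardsU1 iS; lia.
(* If [i] were in [S] but not in [T], then [g T], being below [b i], would be below [g (i |: T)],
   whose rank is smaller. *)
have gsub (S T : {set 'I_q}) : g S = g T -> S \subset T.
  move=> E; apply/fintype.subsetP => i iS; apply: contraT => iT.
  have := gU T (g T) i; rewrite (belowxx e_med) // -{2}E gb // => /below_le.
  by rewrite (gr _ _ iT) ltnn.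
pose c (f : cube q) := g [set i | f i]%SET.
have adj (u v : cube q) i : [set j | u j != v j]%SET = [set i]%SET -> ~~ u i -> e (c u) (c v).
  move=> uv ui; have uvE j : (u j != v j) = (j == i).
    by have /setP/(_ j) := uv; rewrite !inE.
  have vE : [set j | v j]%SET = i |: [set j | u j]%SET.
    apply/setP => j; rewrite !inE; have := uvE j; case: (eqVneq j i) => [->|_] /=.
      by rewrite (negbTE ui); case: (v i).
    by move=> /negbFE/eqP ->.
  rewrite e_sym; apply: (dist1 e_irr e_con); rewrite /c vE.
  have := gU [set j | u j]%SET (g (i |: [set j | u j]%SET)) i.
  rewrite (belowxx e_med) => /esym/andP[/eqP + _].
  by rewrite (@gr _ i) ?inE // -addn1 => /addnI/esym.
(* The second clause of [CAT0] supplies the cell: the corner map only has to be injective and to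
   send edges to edges. *)
exists c; apply: K_CAT0.2 => [u v /[dup] /gsub uv /esym/gsub vu|u v].
  have /setP E : [set j | u j]%SET = [set j | v j]%SET by apply/eqP; rewrite finset.eqEsubset uv.
  by apply/ffunP => j; have := E j; rewrite !inE.
move=> /eqP /cards1P[i uv].
have : u i != v i by have /setP/(_ i) := uv; rewrite !inE eqxx.
case ui: (u i) => vi; last by apply: (adj _ _ i); rewrite ?ui.
rewrite e_sym; apply: (adj _ _ i); last by case: (v i) vi.
by rewrite -uv; apply/setP => j; rewrite !inE eq_sym.
Qed.

Variable N : nat.
Hypothesis K_dim : has_dimension K N.

(** A family of lower covers spans a cube, so it has at most [N] members; one of maximal size
    contains every lower cover. *)
Lemma lcover_seq m : exists B, [/\ uniq B, (size B <= N)%N &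
  forall b, (b \in B) = lcover b m].
Proof.
pose P n := `[< exists B, [/\ uniq B, all (lcover^~ m) B & size B = n] >].
have exP : exists n, P n by exists 0%N; apply/asboolP; exists [::].
have bnd B : uniq B -> all (lcover^~ m) B -> (size B <= N)%N.
  by move=> uB Bm; have [c /K_dim.2] := lcover_cell uB Bm.
have ubP n : P n -> (n <= N)%N.
  by move=> /asboolP[B [uB Bm <-]]; apply: bnd.
case: (ex_maxnP exP ubP) => n /asboolP[B [uB Bm sB]] nmax.
exists B; split => [//||b]; first exact: bnd.
apply/idP/idP => [|bm]; first exact: (allP Bm).
apply: contraT => bB.
suff /nmax : P n.+1 by rewrite ltnn.
by apply/asboolP; exists (b :: B); split; rewrite /= ?bB ?bm ?sB.
Qed.

Definition lcovers m := projT1 (cid (lcover_seq m)).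

Lemma lcovers_uniq m : uniq (lcovers m).
Proof. by rewrite /lcovers; case: cid => B []. Qed.

Lemma lcovers_size m : (size (lcovers m) <= N)%N.
Proof. by rewrite /lcovers; case: cid => B []. Qed.

Lemma mem_lcovers m b : (b \in lcovers m) = lcover b m.
Proof. by rewrite /lcovers; case: cid => B []. Qed.

Lemma lcovers_gt0 m : (0 < size (lcovers m))%N = (m != o).
Proof.
apply/idP/idP => [|].
  case E: (lcovers m) => [//|b B] _; have : lcover b m by rewrite -mem_lcovers E mem_head.
  by move=> /lcover_rank rb; apply/eqP => mo; move: rb; rewrite mo (distxx e_con).
rewrite eq_sym => om; have [b] := below_lcover e_sym e_irr e_med (below0 e_med o m) om.
by rewrite -mem_lcovers; case: (lcovers m).
Qed.

(* Splitting off a lower cover [b] of [m] leaves the vertices that are not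
   below [b], and those below [b] but not below any of the lower covers
   [meet b c] of [b], for [c] in [B]. *)
Lemma below_enum m B : uniq B -> all (lcover^~ m) B -> exists L : seq K,
  [/\ uniq L, forall v, (v \in L) = below v m && ~~ has (below v) B,
      forall i, (count (fun v => rk v + i == rk m) L <= 'C(N - size B + i - 1, i))%N &
      \sum_(v <- L) 'X^(rk m - rk v) * (1 - 'X) ^+ size (lcovers v) =
        (1 - 'X) ^+ size B :> {poly int}].
Proof.
(* Both recursive calls lower this measure: enlarging [B] by [b] lowers the second term, and passing
   from [m] to [b] with a family of the same size lowers the first. *)
have [n] := ubnP (rk m + (N - size B))%N.
elim: n m B => // n IH m B mn uB Bm.
have subB : {subset B <= lcovers m} by move=> b /(allP Bm); rewrite mem_lcovers.
have sB : (size B <= N)%N.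
  by apply: leq_trans (lcovers_size m); apply: uniq_leq_size.
case: (boolP (has [predC B] (lcovers m))) => [/hasP[b /[!mem_lcovers] bm /= bB]|]; last first.
  (* When [B] holds all lower covers of [m], only [m] itself remains. *)
  rewrite has_predC negbK => /allP Bsub.
  have eB : B =i lcovers m by move=> b; apply/idP/idP => [/subB|/Bsub].
  exists [:: m]; split => //.
  - move=> v; rewrite mem_seq1; apply/eqP/andP => [->|[vm /hasP vB]].
      rewrite (belowxx e_med); split => //; apply/hasPn => b.
      by move=> /(allP Bm)/lcover_rank bm; apply/negP => /below_le; rewrite bm ltnn.
    apply/eqP; apply: contraT => vNm; case: vB.
    have [b bm vb] := below_lcover e_sym e_irr e_med vm vNm.
    by exists b => //; rewrite eB mem_lcovers.
  - case=> [|i] /=; first by rewrite !addn0 eqxx bin0.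
    by rewrite -{2}[rk m]addn0 eqn_add2l.
  - rewrite big_seq1 subnn mul1r; congr (_ ^+ _); apply/esym/perm_size.
    exact: uniq_perm (lcovers_uniq m) eB.
have u1 : uniq (b :: B) by rewrite /= bB.
have m1 : all (lcover^~ m) (b :: B) by rewrite /= bm.
have s1 : (size B < N)%N.
  apply: (@leq_trans (size (lcovers m))) (lcovers_size m).
  by apply: (@uniq_leq_size _ (b :: B)) => // c /(allP m1); rewrite mem_lcovers.
have rb := lcover_rank bm.
have [u2 m2] := lcover_meets e_sym e_med u1 m1.
have [|L1 [uL1 L1E cL1 pL1]] := IH m (b :: B) _ u1 m1.
  by rewrite /=; move: (rk m) (size B) mn s1 => x y; clear; lia.
have [|L2 [uL2 L2E cL2 pL2]] := IH b _ _ u2 m2.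
  by rewrite size_map; move: mn; rewrite rb; move: (rk b) (size B) => x y; clear; lia.
rewrite size_map in cL2 pL2.
have {}L2E v : (v \in L2) = below v b && ~~ has (below v) B.
  rewrite L2E; case vb: (below v b) => //=; congr negb; rewrite has_map.
  by apply: eq_has => c /=; rewrite below_meet vb.
exists (L1 ++ L2); split.
- rewrite cat_uniq uL1 uL2 andbT /=; apply/hasPn => v.
  by rewrite /= L2E L1E /= => /andP[-> _]; rewrite andbF.
- move=> v; rewrite mem_cat L1E L2E /= negb_or.
  case vb: (below v b); rewrite ?andbF ?orbF //=.
  by rewrite (below_trans e_med vb (lcover_below bm)).
- move=> i; rewrite count_cat; have := cL1 i; rewrite /=.
  case: i => [|i] c1.
    rewrite !bin0 in c1 *; rewrite (@eq_in_count _ _ pred0 L2).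
      by rewrite count_pred0 addn0.
    move=> v; rewrite L2E => /andP[/below_le vb _] /=.
    by rewrite addn0 rb ltn_eqF.
  (* Depth [i.+1] under [m] is depth [i] under [b], and Pascal's rule adds the two bounds. *)
  have := cL2 i.
  rewrite (@eq_count _ _ (fun v => rk v + i.+1 == rk m)%N); last first.
    by move=> v /=; rewrite rb addnS eqSS.
  move=> c2; apply: leq_trans (leq_add c1 c2) _.
  have -> : (N - (size B).+1 + i.+1 - 1 = N - size B + i - 1)%N by clear -s1; lia.
  have -> : (N - size B + i.+1 - 1 = (N - size B + i - 1).+1)%N by clear -s1; lia.
  by rewrite binS addnC.
(* With [q = size B] this is [(1 - 'X) ^+ q.+1 + 'X * (1 - 'X) ^+ q = (1 - 'X) ^+ q]. *)
- rewrite big_cat /= pL1 /=.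
  rewrite (eq_big_seq (fun v => 'X * ('X^(rk b - rk v) * (1 - 'X) ^+ size (lcovers v)))).
    by rewrite -mulr_sumr pL2 exprS; ring.
  move=> v; rewrite L2E => /andP[/below_le vb _].
  by rewrite rb subSn // exprS mulrA.
Qed.

(** * Telescoping the radial kernel *)

Section Kernel.
Variable C : comNzRingType.
Implicit Types (f phi : nat -> C) (p : {poly int}).

(** The linear functional ['X^i |-> f i] on polynomials of size at most [B]; it turns polynomial
    identities into identities between values of [f]. *)
Let pairing f B p : C := \sum_(i < B) (p`_i)%:~R * f i.

Let pairing_sum f B (T : Type) (r : seq T) (F : T -> {poly int}) :
  pairing f B (\sum_(t <- r) F t) = \sum_(t <- r) pairing f B (F t).
Proof.
rewrite /pairing exchange_big; apply: eq_bigr => i _.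
by rewrite coef_sum rmorph_sum mulr_suml.
Qed.

Let pairing_monom f B c j : (j < B)%N ->
  pairing f B (c *: 'X^j) = c%:~R * f j.
Proof.
move=> jB; rewrite /pairing (bigD1 (Ordinal jB)) //= big1 => [|i ij].
  by rewrite coefZ coefXn eqxx mulr1 addr0.
by rewrite coefZ coefXn (negbTE (ij : (i : nat) != j)) mulr0 mul0r.
Qed.

(** Summation by parts: multiplication by [1 - 'X] is adjoint to the difference operator. *)
Let pairing_diff f B p : (size p <= B)%N ->
  pairing f B.+1 ((1 - 'X) * p) = pairing (fun i => f i - f i.+1) B p.
Proof.
move=> sp; rewrite /pairing.
under eq_bigr do rewrite mulrBl mul1r coefB coefXM rmorphB mulrBl.
rewrite sumrB big_ord_recr big_ord_recl /= mul0r add0r.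
rewrite (nth_default _ sp) mul0r addr0 -sumrB.
by apply: eq_bigr => i _; rewrite mulrBr.
Qed.

(** The binomial expansion is padded with vanishing binomials, so that the range of [s] does not
    depend on the vertex. *)
Let pow_expand (a c n : nat) : (c < n)%N ->
  'X^a * (1 - 'X) ^+ c = \sum_(s < n) ((-1) ^+ s * ('C(c, s))%:R) *: 'X^(a + s)
  :> {poly int}.
Proof.
move=> cn; rewrite exprBn (big_ord_widen n (fun i =>
  ((-1) ^+ i * 1 ^+ (c - i) * 'X^i) *+ 'C(c, i) : {poly int})) //.
rewrite big_mkcond mulr_sumr; apply: eq_bigr => s _.
case: ifPn => [_|]; last first.
  by rewrite -leqNgt => cs; rewrite bin_small // mulr0n !mulr0 scale0r.
rewrite expr1n mulr1 exprD -mul_polyC rmorphM rmorphXn rmorphN1 rmorph_nat.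
by rewrite -mulr_natr; ring.
Qed.

(** The coefficient of ['X^s] in the power of [1 - 'X] whose exponent is the number of lower covers
    less one, or 0 at the base vertex. *)
Definition lcover_coef v s : C := (-1) ^+ s * ('C((size (lcovers v)).-1, s))%:R.

(* Multiplying by [1 - X], the sum over the vertices [v] below [meet x y] is
   [\sum_v X^(rk m - rk v) (1 - X)^max(q v, 1) = 1 - X^(rk m + 1)], paired
   with [phi (d x y + 2 i)]; here [q v] counts the lower covers of [v].  The
   sum over [k] is the contribution of a ray attached at the base vertex. *)
Lemma kernel_expand phi (x y : K) (U : seq K) (P : nat) : (0 < N)%N ->
  uniq U -> (forall v, below v x -> below v y -> v \in U) ->
  \sum_(v <- U) \sum_(s < N) ((below v x)%:R * lcover_coef v s * (below v y)%:R *
     (phi (rk x - rk v + s + (rk y - rk v + s))%N -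
      phi (rk x - rk v + s + (rk y - rk v + s) + 2)%N)) +
  \sum_(k < P) (phi (rk x + k.+1 + (rk y + k.+1))%N -
      phi (rk x + k.+1 + (rk y + k.+1) + 2)%N)
  = phi (dist e x y) - phi (rk x + rk y + (P.+1).*2)%N.
Proof.
move=> N0 uU Usub; set m := meet e_sym e_med o x y.
have dm : (dist e x y + (rk m).*2 = rk x + rk y)%N := dist_meet e_sym e_med o x y.
have mE v : below v m = below v x && below v y := below_meet e_sym e_med o v x y.
have [L [uL LE _ pL]] := @below_enum m [::] isT isT.
rewrite /= expr0 in pL.
have {}LE v : (v \in L) = below v m by rewrite LE andbT.
(* Truncation gives [q o = 0], so [(q v).+1] is the number of lower covers except at [o], where it
   is 1. *)
pose q v := (size (lcovers v)).-1.
have qN v : (q v < N)%N.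
  by rewrite /q; have := lcovers_size v; case: (size _).
(* Compared with [pL], only the term at [o] changes: its extra factor [1 - 'X] subtracts
   ['X^((rk m).+1)]. *)
have pL1 : \sum_(v <- L) 'X^(rk m - rk v) * (1 - 'X) ^+ (q v).+1 =
    1 - 'X^((rk m).+1) :> {poly int}.
  have oL : o \in L by rewrite LE below0.
  have r0 : rk o = 0%N := distxx e_con o.
  have q0 : size (lcovers o) = 0%N.
    by apply/eqP; rewrite -leqn0 leqNgt lcovers_gt0 eqxx.
  move: pL; rewrite !(bigD1_seq o oL uL) /= /q q0 r0 subn0 expr0 expr1 mulr1.
  move=> /(canRL (addKr _)) pL.
  rewrite (eq_bigr (fun v => 'X^(rk m - rk v) * (1 - 'X) ^+ size (lcovers v))).
    by rewrite pL mulrBr mulr1 -exprSr addrC addrACA addNr add0r.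
  by move=> v vo; rewrite prednK // lcovers_gt0.
(* For [v] below [m], [(rk x - rk v) + (rk y - rk v)] is [dist e x y] plus twice the depth of [v]
   under [m], so ['X^i] stands for [f i]. *)
pose f i := phi (dist e x y + i.*2)%N.
pose B := (rk m + N).+1.
have split_U : \sum_(v <- U) \sum_(s < N) ((below v x)%:R * lcover_coef v s * (below v y)%:R *
     (phi (rk x - rk v + s + (rk y - rk v + s))%N -
      phi (rk x - rk v + s + (rk y - rk v + s) + 2)%N)) =
    \sum_(v <- L) pairing (fun i => f i - f i.+1) B ('X^(rk m - rk v) * (1 - 'X) ^+ q v).
  have pUL : perm_eq [seq v <- U | below v m] L.
    apply: uniq_perm; rewrite ?filter_uniq // => v.
    rewrite mem_filter LE andb_idr // mE => /andP[]; exact: Usub.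
  rewrite -(perm_big _ pUL) big_filter [RHS]big_mkcond; apply: eq_bigr => v _.
  case: ifPn => [vm|]; last first.
    rewrite mE negb_and => vm; apply: big1 => s _.
    by case: (below v x) vm => /= [/negbTE->|_]; rewrite ?mulr0 !mul0r.
  have rv := below_le vm; move: vm; rewrite mE => /andP[vx vy].
  have rvx := below_le vx; have rvy := below_le vy.
  rewrite (pow_expand _ (qN v)) pairing_sum; apply: eq_bigr => s _.
  rewrite pairing_monom; last by rewrite /B ltnS leq_add ?leq_subr // ltnW.
  rewrite vx vy mul1r mulr1 rmorphM rmorphXn rmorphN1 rmorph_nat /f.
  congr (_ * (phi _ - phi _)); move: rv rvx rvy dm.
    by move: (rk v) (rk m) (rk x) (rk y) (dist e x y) (s : nat); clear; lia.
  by move: (rk v) (rk m) (rk x) (rk y) (dist e x y) (s : nat); clear; lia.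
have tel : \sum_(k < P) (phi (rk x + k.+1 + (rk y + k.+1))%N -
      phi (rk x + k.+1 + (rk y + k.+1) + 2)%N) =
   phi (rk x + rk y + 2)%N - phi (rk x + rk y + (P.+1).*2)%N.
  elim: P => [|P' IH]; first by rewrite big_ord0 subrr.
  rewrite big_ord_recr /= IH.
  have -> : (rk x + P'.+1 + (rk y + P'.+1) = rk x + rk y + (P'.+1).*2)%N by clear; lia.
  have -> : (rk x + rk y + (P'.+1).*2 + 2 = rk x + rk y + (P'.+2).*2)%N by clear; lia.
  by rewrite addrA addrNK.
rewrite split_U tel.
(* The difference operator becomes a factor [1 - 'X] again, which brings in the closed form
   [pL1]. *)
under eq_bigr => v _.
  rewrite -pairing_diff; last first.
    apply: leq_trans (size_polyMleq _ _) _; rewrite size_polyXn /=.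
    apply: leq_trans (leq_add (leqnn _) (size_poly_exp_leq _ _)) _.
    rewrite -opprB size_polyN size_XsubC /= mul1n /B addnS ltnS leq_add ?leq_subr //.
    exact: ltnW.
  rewrite mulrCA -exprS.
  over.
rewrite -pairing_sum pL1.
have -> : 1 - 'X^((rk m).+1) =
    \sum_(c <- [:: (1 : int, 0%N); (-1, (rk m).+1)]) c.1 *: 'X^(c.2) :> {poly int}.
  by rewrite big_cons big_seq1 /= scale1r scaleN1r.
rewrite pairing_sum big_cons big_seq1 /= !pairing_monom // ?ltnS; last first.
  exact: leq_addr.
rewrite /f rmorphN1 mul1r mulN1r addn0.
have -> : (dist e x y + (rk m).+1.*2 = rk x + rk y + 2)%N by rewrite -dm; clear; lia.
by rewrite addrA addrNK.
Qed.

End Kernel.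

(** The vertices are grouped by their depth under [x], and each group is counted by [below_enum]
    with [B] empty. *)
Lemma below_sum_le (F : numDomainType) (g : nat -> F) (U : seq K) x D :
  uniq U -> (forall i, 0 <= g i) -> (rk x < D)%N ->
  \sum_(v <- U) (below v x)%:R * g (rk x - rk v)%N <=
  \sum_(i < D) ('C(N + i - 1, i))%:R * g i.
Proof.
move=> uU g0 xD.
have [L [uL LE cL _]] := @below_enum x [::] isT isT.
have {}LE v : (v \in L) = below v x by rewrite LE andbT.
rewrite (eq_bigr (fun v => \sum_(i < D)
    ((below v x) && (rk v + i == rk x)%N)%:R * g i)); last first.
  move=> v _; case vx: (below v x) => /=; last first.
    by rewrite mul0r big1 // => i _; rewrite mul0r.
  have lt_D : (rk x - rk v < D)%N by apply: leq_ltn_trans xD; apply: leq_subr.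
  rewrite (bigD1 (Ordinal lt_D)) //= subnKC ?below_le // eqxx big1 ?addr0 // => i iN.
  case: eqP => [E|]; last by rewrite mul0r.
  by case/eqP: iN; apply: val_inj; rewrite /= -E addKn.
rewrite exchange_big /=; apply: ler_sum => i _.
rewrite -mulr_suml ler_wpM2r // -natr_sum ler_nat.
apply: leq_trans (leq_trans (cL i) _); last by rewrite subn0.
rewrite (eq_bigr (fun v => if below v x && (rk v + i == rk x)%N then 1 else 0)%N).
  rewrite -big_mkcond sum1_count -!size_filter uniq_leq_size ?filter_uniq // => v.
  by rewrite !mem_filter LE /= => /andP[/andP[-> ->]].
by move=> v _; case: ifP.
Qed.

End Skeleton.

(** * Complex modulus and positive forms *)

Section Cabs.
Variable R : realType.
Implicit Types z w : R[i].

Lemma cabsC z : (cabs z)%:C%C = `|z|.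
Proof. by rewrite normc_def /cabs; case: z. Qed.

Lemma cabs_ge0 z : 0 <= cabs z.
Proof. by rewrite -lecR cabsC; exact: normr_ge0. Qed.

Lemma cabs0 : cabs 0 = 0 :> R.
Proof. exact: ComplexField.Normc.normc0. Qed.

Lemma cabsM z w : cabs (z * w) = cabs z * cabs w.
Proof. exact: ComplexField.Normc.normcM. Qed.

Lemma cabsD z w : cabs (z + w) <= cabs z + cabs w.
Proof. by rewrite -lecR rmorphD /= !cabsC ler_normD. Qed.

Lemma cabsN z : cabs (- z) = cabs z.
Proof. by apply: complexI; rewrite !cabsC normrN. Qed.

Lemma cabsJ z : cabs z^* = cabs z.
Proof. by apply: complexI; rewrite !cabsC norm_conjC. Qed.

Lemma cabsr (r : R) : 0 <= r -> cabs r%:C%C = r.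
Proof. by move=> r0; apply: complexI; rewrite cabsC ger0_norm ?lecR. Qed.

Lemma cabs_norm (r : R) : cabs r%:C%C = `|r|.
Proof. by rewrite /cabs /= expr0n addr0 sqrtr_sqr. Qed.

Lemma cabs_nat n : cabs n%:R = n%:R :> R.
Proof. by rewrite -(rmorph_nat (real_complex R)) cabs_norm ger0_norm. Qed.

Lemma cabs_sum (I : Type) (s : seq I) (F : I -> R[i]) :
  cabs (\sum_(i <- s) F i) <= \sum_(i <- s) cabs (F i).
Proof.
rewrite -lecR cabsC rmorph_sum /=; apply: le_trans (ler_norm_sum _ _ _) _.
by apply: ler_sum => i _; rewrite cabsC.
Qed.

Lemma cabs2 z : (cabs z ^+ 2)%:C%C = z * z^*.
Proof. by rewrite rmorphXn /= cabsC normCK. Qed.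

Lemma cabs_eq0 z : cabs z = 0 -> z = 0.
Proof. exact: ComplexField.Normc.eq0_normc. Qed.

End Cabs.

(** * Positive semidefinite Hermitian forms *)

Section Form.
Variables (R : realType) (V : lmodType R[i]) (Q : V -> V -> R[i]).
Hypothesis Q_lin : forall a f g h, Q (a *: f + g) h = a * Q f h + Q g h.
Hypothesis Q_sym : forall f g, Q g f = (Q f g)^*.
Hypothesis Q_pos : forall f, 0 <= Q f f.

Lemma psd0l h : Q 0 h = 0.
Proof.
have /eqP := Q_lin 1 0 0 h; rewrite scale1r addr0 mul1r.
by rewrite -subr_eq0 opprD addrA subrr sub0r oppr_eq0 => /eqP.
Qed.

Lemma psdDl f g h : Q (f + g) h = Q f h + Q g h.
Proof. by rewrite -[f in LHS]scale1r Q_lin mul1r. Qed.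

Lemma psdZl a f h : Q (a *: f) h = a * Q f h.
Proof. by rewrite -[_ *: f]addr0 Q_lin psd0l addr0. Qed.

Lemma psdBl f g h : Q (f - g) h = Q f h - Q g h.
Proof. by rewrite -scaleN1r psdDl psdZl mulN1r. Qed.

Lemma psd_suml (I : Type) (s : seq I) (F : I -> V) h :
  Q (\sum_(i <- s) F i) h = \sum_(i <- s) Q (F i) h.
Proof.
elim: s => [|i s IH]; first by rewrite !big_nil psd0l.
by rewrite !big_cons psdDl IH.
Qed.

Lemma psd0r h : Q h 0 = 0.
Proof. by rewrite Q_sym psd0l conjC0. Qed.

Lemma psdDr f g h : Q h (f + g) = Q h f + Q h g.
Proof. by rewrite Q_sym psdDl rmorphD /= -!Q_sym. Qed.

Lemma psdZr a f h : Q h (a *: f) = a^* * Q h f.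
Proof. by rewrite Q_sym psdZl rmorphM /= -Q_sym. Qed.

Lemma psdBr f g h : Q h (f - g) = Q h f - Q h g.
Proof. by rewrite Q_sym psdBl rmorphB /= -!Q_sym. Qed.

Lemma psd_sumr (I : Type) (s : seq I) (F : I -> V) h :
  Q h (\sum_(i <- s) F i) = \sum_(i <- s) Q h (F i).
Proof. by rewrite Q_sym psd_suml rmorph_sum; apply: eq_bigr => i _; rewrite /= -Q_sym. Qed.

Lemma psd_CS f g : `|Q f g| ^+ 2 <= Q f f * Q g g.
Proof.
set c := Q f g; have cE : Q g f = c^* by rewrite Q_sym.
have cc : c * c^* = `|c| ^+ 2 by rewrite normCK.
have [g0|g0] := eqVneq (Q g g) 0; last first.
  have gp : 0 < Q g g by rewrite lt_def g0 Q_pos.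
  have gr : (Q g g)^* = Q g g by rewrite -Q_sym.
  have := Q_pos (Q g g *: f - c *: g).
  rewrite psdBl !psdBr !psdZl !psdZr cE gr -/c -subr_ge0.
  have -> : Q g g * (Q g g * Q f f) - Q g g * (c^* * c) -
     (c * (Q g g * c^*) - c * (c^* * Q g g)) - 0 =
     Q g g * (Q f f * Q g g - c * c^*) by ring.
  by rewrite pmulr_rge0 // cc subr_ge0.
rewrite g0 mulr0 -normrX normr_le0 expf_eq0 /=; apply: contraT => c0.
have cp : 0 < `|c| ^+ 2 by rewrite exprn_gt0 // normr_gt0.
(* In the degenerate case [Q g g = 0], this [t] makes the form at [f - (t * c) *: g] equal to -1
   unless [c = 0]. *)
pose t := (Q f f + 1) / (2 * `|c| ^+ 2).
have tr : t^* = t by apply/CrealP/ger0_real; 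
  rewrite divr_ge0 ?addr_ge0 ?Q_pos ?mulr_ge0 ?exprn_ge0.
have := Q_pos (f - (t * c) *: g).
rewrite psdBl !psdBr !psdZl !psdZr g0 cE -/c rmorphM /= tr.
have -> : Q f f - t * c^* * c - (t * c * c^* - t * c * (t * c^* * 0)) =
   Q f f - 2 * t * (c * c^*) by ring.
rewrite cc (_ : 2 * t * _ = Q f f + 1); last first.
  by rewrite /t; move: cp; move: (`|c| ^+ 2) => u u0; field; rewrite gt_eqF.
by rewrite opprD addNKr oppr_ge0 ler10.
Qed.

Lemma psd_null f g : Q f f = 0 -> Q f g = 0.
Proof.
move=> f0; have := psd_CS f g; rewrite f0 mul0r -normrX normr_le0 expf_eq0 /=.
by move=> /eqP.
Qed.

(** Zero vectors are allowed, since a vector that is null for a degenerate form cannot be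
    normalised. *)
Definition orthonormal0 (g : nat -> V) n :=
  (forall k l, (k < n)%N -> (l < n)%N -> k != l -> Q (g k) (g l) = 0) /\
  (forall k, (k < n)%N -> g k = 0 \/ Q (g k) (g k) = 1).

Definition residue (g : nat -> V) n f := f - \sum_(k < n) Q f (g k) *: g k.

Lemma residue_orth g n f l : orthonormal0 g n -> (l < n)%N ->
  Q (residue g n f) (g l) = 0.
Proof.
move=> [go g1] ln; rewrite psdBl psd_suml (bigD1 (Ordinal ln)) //=.
rewrite psdZl big1 ?addr0 => [|k kl]; last by rewrite psdZl go ?mulr0.
by have [->|->] := g1 l ln; rewrite ?psd0r ?mul0r ?mulr1 ?subrr.
Qed.

Lemma bessel g n f : orthonormal0 g n ->
  \sum_(k < n) `|Q f (g k)| ^+ 2 <= Q f f.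
Proof.
move=> go; have := Q_pos (residue g n f).
rewrite {2}/residue psdBr psd_sumr big1 => [|k _]; last first.
  by rewrite psdZr (residue_orth _ go) ?mulr0.
rewrite subr0 /residue psdBl psd_suml subr_ge0 => /(le_trans _); apply.
by apply: ler_sum => k _; rewrite psdZl (Q_sym f) -normCK.
Qed.

(** Each new vector is the normalised residue of [e n], or 0 when that residue is null; hence the
    [e i] are recovered only up to null vectors. *)
Lemma gram_schmidt (e : nat -> V) n : exists g, orthonormal0 g n /\
  forall i, (i < n)%N -> Q (residue g n (e i)) (residue g n (e i)) = 0.
Proof.
elim: n => [|n [g [go gr]]]; first by exists (fun=> 0); split; [split|].
set r := residue g n (e n).
pose b := if Q r r == 0 then 0 else (sqrtC (Q r r))^-1 *: r.
pose g' k := if k == n then b else g k.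
have g'E k : (k < n)%N -> g' k = g k by rewrite /g' => kn; rewrite ltn_eqF.
have g'n : g' n = b by rewrite /g' eqxx.
have bo k : (k < n)%N -> Q b (g k) = 0.
  move=> kn; rewrite /b; case: ifP => _; first exact: psd0l.
  by rewrite psdZl (residue_orth _ go) ?mulr0.
have b1 : b = 0 \/ Q b b = 1.
  rewrite /b; case: ifP => r0; [by left|right].
  rewrite psdZl psdZr; set s := sqrtC _.
  have s0 : 0 <= s by rewrite sqrtC_ge0.
  rewrite fmorphV /= (CrealP (ger0_real s0)) -[Q r r]sqrtCK -/s.
  by field; rewrite sqrtC_eq0 r0.
have resE f : residue g' n.+1 f = residue g n f - Q f b *: b.
  rewrite /residue big_ord_recr /= g'n opprD addrA; congr (_ - _ - _).
  by apply: eq_bigr => k _; rewrite g'E.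
have Qfb f : Q f b = Q (residue g n f) b.
  rewrite psdBl psd_suml big1 ?subr0 // => k _.
  by rewrite psdZl (Q_sym b) bo // conjC0 mulr0.
exists g'; split; [split|] => [k l|k|i].
- rewrite !ltnS; case: ltngtP => // [kn|->] _.
    case: ltngtP => // [ln|->] _ kl; first by rewrite !g'E // go.1.
    by rewrite g'n g'E // Q_sym bo // conjC0.
  by case: ltngtP => // ln _ _; rewrite g'n g'E ?bo.
- rewrite ltnS; case: ltngtP => // [kn|->] _; last by rewrite g'n.
  by rewrite g'E //; apply: go.2.
- rewrite ltnS resE Qfb; case: ltngtP => // [iLn|->] _.
    by rewrite (psd_null _ (gr _ iLn)) scale0r subr0 gr.
  rewrite -/r /b; case: ifP => [/eqP r0|r0]; first by rewrite scaler0 subr0.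
  rewrite psdZr scalerA; set s := sqrtC _.
  have s0 : 0 <= s by rewrite sqrtC_ge0.
  rewrite fmorphV /= (CrealP (ger0_real s0)) -[Q r r]sqrtCK -/s.
  have -> : s^-1 * s ^+ 2 / s = 1 by field; rewrite sqrtC_eq0 r0.
  by rewrite scale1r subrr psd0l.
Qed.

End Form.

(** * The Hilbert space [l2] *)

Section L2Theory.
Variables (R : realType) (X : choiceType).
Implicit Types (f g h : l2 R X) (A : {fset X}).

Lemma l2val_D f g x : (f + g) x = f x + g x. Proof. by []. Qed.

Lemma l2val_Z a f x : (a *: f) x = a * f x. Proof. by []. Qed.

Lemma l2val_sum (I : Type) (s : seq I) (F : I -> l2 R X) x :
  (\sum_(i <- s) F i) x = \sum_(i <- s) F i x.
Proof. by elim: s => [|i s IH]; rewrite ?big_nil // !big_cons l2val_D IH. Qed.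

Lemma l2P f g : (forall x, f x = g x) -> f = g.
Proof. by move=> fg; apply: val_inj; apply/funext. Qed.

Lemma l2norm_ge0 f : 0 <= l2norm f.
Proof. exact: sqrtr_ge0. Qed.

Lemma sqsumE f : sqsum f = (l2norm f ^+ 2)%:E.
Proof.
have f0 : (0 <= sqsum f)%E by apply: esum_ge0 => x _; rewrite lee_fin sqr_ge0.
rewrite /l2norm sqr_sqrtr ?fine_ge0 // fineK // ge0_fin_numE //.
by case: f {f0} => f /= /asboolP.
Qed.

Lemma sqsum_le (f : X -> R[i]^o) (c : R) :
  (forall A, \sum_(x <- A) cabs (f x) ^+ 2 <= c) -> (sqsum f <= c%:E)%E.
Proof.
move=> fc; apply: ge_ereal_sup => _ [A [finA _] <-].
by rewrite fsbig_finite // sumEFin lee_fin.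
Qed.

Lemma is_l2_le (f : X -> R[i]^o) (c : R) :
  (forall A, \sum_(x <- A) cabs (f x) ^+ 2 <= c) -> f \in @is_l2 R X.
Proof. by move=> /sqsum_le fc; apply/asboolP; apply: le_lt_trans fc (ltry _). Qed.

Lemma l2norm_le f c : 0 <= c ->
  (forall A, \sum_(x <- A) cabs (f x) ^+ 2 <= c ^+ 2) -> l2norm f <= c.
Proof.
move=> c0 /sqsum_le; rewrite sqsumE lee_fin.
by rewrite ler_pXn2r // nnegrE l2norm_ge0.
Qed.

Lemma l2_sum_le f A : \sum_(x <- A) cabs (f x) ^+ 2 <= l2norm f ^+ 2.
Proof.
rewrite -lee_fin -sqsumE -sumEFin; apply: ereal_sup_ubound.
by exists [set` A] => //; rewrite fsbig_finite // set_fsetK.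
Qed.

Lemma le_fset_sum (F : X -> R) A A' : (forall x, 0 <= F x) -> (A `<=` A')%fset ->
  \sum_(x <- A) F x <= \sum_(x <- A') F x.
Proof.
move=> F0 /fsubsetP AA'; rewrite [leRHS](bigID [in A]) /=.
rewrite -[X in _ <= X + _]big_filter.
have -> : \sum_(x <- [seq x <- A' | x \in A]) F x = \sum_(x <- A) F x.
  apply: perm_big; apply: uniq_perm; rewrite ?filter_uniq ?fset_uniq // => x.
  by rewrite mem_filter andb_idr //; apply: AA'.
by rewrite lerDl sumr_ge0.
Qed.

Lemma l2_sum_approx f (eps : R) : 0 < eps -> exists A0, forall A,
  (A0 `<=` A)%fset -> l2norm f ^+ 2 - eps <= \sum_(x <- A) cabs (f x) ^+ 2.
Proof.
move=> e0; have : (((l2norm f ^+ 2 - eps)%:E < sqsum f)%E).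
  by rewrite sqsumE lte_fin ltrBlDr ltrDl.
move=> /ereal_sup_gt[_ [A [finA _] <-]].
rewrite fsbig_finite // sumEFin lte_fin => /ltW lA.
exists (fset_set A) => B AB; apply: le_trans lA _.
by apply: le_fset_sum AB => x; rewrite sqr_ge0.
Qed.

(** The polarisation formula: it expresses the inner product through norms, whose defining sums are
    known to converge. *)
Definition polar f g : R[i] :=
  ((l2norm (f + g) ^+ 2)%:C%C - (l2norm (f - g) ^+ 2)%:C%C +
   'i * ((l2norm (f + 'i *: g) ^+ 2)%:C%C - (l2norm (f - 'i *: g) ^+ 2)%:C%C)) / 4.

Let polar_pt (z w : R[i]) : z * w^* =
  ((cabs (z + w) ^+ 2)%:C%C - (cabs (z - w) ^+ 2)%:C%C +
   'i * ((cabs (z + 'i * w) ^+ 2)%:C%C - (cabs (z - 'i * w) ^+ 2)%:C%C)) / 4.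
Proof.
have ii : 'i * 'i = -1 :> R[i] by rewrite -expr2 sqrCi.
rewrite !cabs2 !(rmorphD, rmorphN, rmorphM) /= conjCi; set z' := z^*; set w' := w^*.
have -> : (z + w) * (z' + w') - (z - w) * (z' - w') +
  'i * ((z + 'i * w) * (z' + - 'i * w') - (z - 'i * w) * (z' - - 'i * w')) =
  2 * z * w' * (1 - 'i * 'i) + 2 * w * z' * (1 + 'i * 'i) by ring.
by rewrite ii subrr; field.
Qed.

Let polar_approx f g (eps : R) : 0 < eps -> exists A0, forall A,
  (A0 `<=` A)%fset -> cabs (\sum_(x <- A) f x * (g x)^* - polar f g) <= eps.
Proof.
move=> e0.
have [A1 H1] := l2_sum_approx (f + g) e0.
have [A2 H2] := l2_sum_approx (f - g) e0.
have [A3 H3] := l2_sum_approx (f + 'i *: g) e0.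
have [A4 H4] := l2_sum_approx (f - 'i *: g) e0.
exists (A1 `|` A2 `|` A3 `|` A4)%fset => A.
rewrite !fsubUset => /andP[/andP[/andP[/H1 {}H1 /H2 {}H2] /H3 {}H3] /H4 {}H4].
pose D h : R := \sum_(x <- A) cabs (h x) ^+ 2 - l2norm h ^+ 2.
have Dle h : l2norm h ^+ 2 - eps <= \sum_(x <- A) cabs (h x) ^+ 2 -> cabs (D h)%:C%C <= eps.
  move=> h1; have h2 := l2_sum_le h A.
  have -> : D h = - (l2norm h ^+ 2 - \sum_(x <- A) cabs (h x) ^+ 2) by rewrite opprB.
  by rewrite cabs_norm normrN ger0_norm ?subr_ge0 // lerBlDr -lerBlDl.
have -> : \sum_(x <- A) f x * (g x)^* - polar f g =
    ((D (f + g))%:C%C - (D (f - g))%:C%C +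
     'i * ((D (f + 'i *: g))%:C%C - (D (f - 'i *: g))%:C%C)) / 4.
  rewrite (eq_bigr _ (fun x _ => polar_pt (f x) (g x))) -mulr_suml big_split /=.
  rewrite -mulr_sumr !sumrB /polar /D !rmorphB !rmorph_sum /=.
  have alg (u a b c d a' b' c' d' : R[i]) :
    (a - b + u * (c - d)) / 4 - (a' - b' + u * (c' - d')) / 4 =
    (a - a' - (b - b') + u * (c - c' - (d - d'))) / 4 by ring.
  exact: alg.
rewrite cabsM; apply: (@le_trans _ _ ((eps + eps + (eps + eps)) / 4)); last by lra.
have -> : cabs (4^-1 : R[i]) = 4^-1.
  by rewrite (_ : 4^-1 = (4^-1)%:C%C) ?cabsr ?invr_ge0 // fmorphV rmorph_nat.
have ci : cabs ('i : R[i]) = 1 by apply: complexI; rewrite cabsC normCi.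
rewrite ler_pM2r // (le_trans (cabsD _ _)) // lerD //.
  by rewrite (le_trans (cabsD _ _)) // cabsN lerD // Dle.
by rewrite cabsM ci mul1r (le_trans (cabsD _ _)) // cabsN lerD // Dle.
Qed.

(** The partial sums converge to [polar f g], so the limit defining [inner] is genuine. The algebra
    of [inner] is then read off finite sums. *)
Lemma inner_approx f g (eps : R) : 0 < eps -> exists A0, forall A,
  (A0 `<=` A)%fset -> cabs (\sum_(x <- A) f x * (g x)^* - inner f g) <= eps.
Proof.
suff -> : inner f g = polar f g by apply: polar_approx.
rewrite /inner /summability.sum.
have totally_pf := @summability.totally_filter X.
apply: (@cvg_lim _ (@norm_hausdorff R[i] (R[i]^o)) _ _ totally_pf
  (summability.partial_sum (fun x => f x * (g x)^* : R[i]^o)) (polar f g)).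
apply/(@cvgrPdist_le R[i] (R[i]^o)) => eps1 e0.
have e1 : eps1 = (complex.Re eps1)%:C%C by rewrite RRe_real // gtr0_real.
have e2 : 0 < complex.Re eps1 by rewrite -ltcR -e1.
have [A0 A0P] := polar_approx f g e2.
exists A0 => // A /A0P.
rewrite -lecR cabsC -e1 distrC /summability.partial_sum.
by rewrite big_seq_fsetE.
Qed.

End L2Theory.

Section Inner.
Variables (R : realType) (X : choiceType).
Implicit Types (f g h : l2 R X) (A : {fset X}).

Lemma cabs_small (z : R[i]) (c : R) : (forall eps, 0 < eps -> cabs z <= c * eps) ->
  z = 0.
Proof.
move=> zc; apply: cabs_eq0; apply/eqP; rewrite eq_le cabs_ge0 andbT.
apply/ler_addgt0Pl => eps e0; rewrite addr0.
have c1 : 0 < `|c| + 1 by rewrite ltr_pwDr.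
apply: le_trans (zc (eps / (`|c| + 1)) (divr_gt0 e0 c1)) _.
rewrite mulrCA -[leRHS]mulr1 (ler_pM2l e0) ler_pdivrMr // mul1r.
by rewrite (le_trans (ler_norm c)) // lerDl.
Qed.

Lemma inner_lin a f g h : inner (a *: f + g) h = a * inner f h + inner g h.
Proof.
apply/eqP; rewrite -subr_eq0; apply/eqP.
apply: (@cabs_small _ (1 + (cabs a + 1))) => eps e0.
have [A2 H2] := inner_approx (a *: f + g) h e0.
have [A3 H3] := inner_approx f h e0.
have [A4 H4] := inner_approx g h e0.
set A := (A2 `|` A3 `|` A4)%fset.
have {}H2 : cabs _ <= eps := H2 A (fsubset_trans (fsubsetUl _ _) (fsubsetUl _ _)).
have {}H3 : cabs _ <= eps := H3 A (fsubset_trans (fsubsetUr _ _) (fsubsetUl _ _)).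
have {}H4 : cabs _ <= eps := H4 A (fsubsetUr _ _).
have E : \sum_(x <- A) (a *: f + g) x * (h x)^* =
    a * (\sum_(x <- A) f x * (h x)^*) + \sum_(x <- A) g x * (h x)^*.
  rewrite mulr_sumr -big_split; apply: eq_bigr => x _.
  by rewrite [RHS]/= mulrA -mulrDl.
move: H2 H3 H4; rewrite E.
move: (\sum_(x <- A) f x * (h x)^*) (\sum_(x <- A) g x * (h x)^*) => u v H2 H3 H4.
have -> : inner (a *: f + g) h - (a * inner f h + inner g h) =
  - (a * u + v - inner (a *: f + g) h) + (a * (u - inner f h) + (v - inner g h)) by ring.
rewrite (le_trans (cabsD _ _)) // cabsN mulrDl mul1r lerD //.
rewrite (le_trans (cabsD _ _)) // mulrDl mul1r lerD //.
by rewrite cabsM ler_wpM2l ?cabs_ge0.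
Qed.

Lemma inner_sym f g : inner g f = (inner f g)^*.
Proof.
apply/eqP; rewrite -subr_eq0; apply/eqP.
apply: (@cabs_small _ 2) => eps e0.
have [A1 H1] := inner_approx f g e0.
have [A2 H2] := inner_approx g f e0.
have {}H1 : cabs _ <= eps := H1 _ (fsubsetUl A1 A2).
have {}H2 : cabs _ <= eps := H2 _ (fsubsetUr A1 A2).
have E : \sum_(x <- (A1 `|` A2)%fset) g x * (f x)^* =
    (\sum_(x <- (A1 `|` A2)%fset) f x * (g x)^*)^*.
  by rewrite rmorph_sum; apply: eq_bigr => x _; rewrite /= rmorphM /= conjCK mulrC.
move: H1 H2; rewrite E; move: (\sum_(x <- _) _) => u H1 H2.
have -> : inner g f - (inner f g)^* = - (u^* - inner g f) + (u - inner f g)^*.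
  by rewrite rmorphB /=; ring.
by rewrite (le_trans (cabsD _ _)) // cabsN cabsJ mulr2n mulrDl mul1r lerD.
Qed.

Lemma inner_ff f : inner f f = (l2norm f ^+ 2)%:C%C.
Proof.
apply/eqP; rewrite -subr_eq0; apply/eqP.
apply: (@cabs_small _ 2) => eps e0.
have [A1 H1] := inner_approx f f e0.
have [A2 H2] := l2_sum_approx f e0.
have {}H1 : cabs _ <= eps := H1 _ (fsubsetUl A1 A2).
have {}H2 := H2 _ (fsubsetUr A1 A2).
have H3 := l2_sum_le f (A1 `|` A2)%fset.
have E : \sum_(x <- (A1 `|` A2)%fset) f x * (f x)^* =
    (\sum_(x <- (A1 `|` A2)%fset) cabs (f x) ^+ 2)%:C%C.
  by rewrite rmorph_sum; apply: eq_bigr => x _; rewrite /= -cabs2.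
move: H1 H2 H3; rewrite E; move: (\sum_(x <- _) _) => u H1 H2 H3.
have -> : inner f f - (l2norm f ^+ 2)%:C%C = - (u%:C%C - inner f f) + (u - l2norm f ^+ 2)%:C%C.
  by rewrite rmorphB /=; ring.
rewrite (le_trans (cabsD _ _)) // cabsN mulr2n mulrDl mul1r lerD // cabs_norm.
by rewrite ler0_norm ?subr_le0 // opprB lerBlDr -lerBlDl.
Qed.

Lemma inner_ge0 f : 0 <= inner f f.
Proof. by rewrite inner_ff ler0c sqr_ge0. Qed.

Lemma inner_delta f x : inner f (delta R x) = f x.
Proof.
apply/eqP; rewrite -subr_eq0; apply/eqP.
apply: (@cabs_small _ 1) => eps e0.
have [A1 H1] := inner_approx f (delta R x) e0.
have {}H1 : cabs _ <= eps := H1 _ (fsubsetUl A1 [fset x]%fset).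
have xA : x \in (A1 `|` [fset x])%fset by rewrite !inE eqxx orbT.
move: H1; rewrite (bigD1_seq x) //= eqxx conjC1 mulr1 big1; last first.
  by move=> y /negbTE ->; rewrite conjC0 mulr0.
by rewrite addr0 mul1r -cabsN opprB.
Qed.

Lemma entryE (T : l2 R X -> l2 R X) x y : entry T x y = T (delta R y) x.
Proof. exact: inner_delta. Qed.

Lemma l2normZ a f : l2norm (a *: f) = cabs a * l2norm f.
Proof.
apply/eqP; rewrite -(@eqrXn2 _ 2) ?mulr_ge0 ?l2norm_ge0 ?cabs_ge0 //; apply/eqP.
apply: complexI; rewrite -inner_ff (psdZl inner_lin) (psdZr inner_lin inner_sym).
by rewrite exprMn rmorphM /= inner_ff cabs2 mulrA.
Qed.

Lemma l2norm_eq0 f : l2norm f = 0 -> f = 0.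
Proof.
move=> f0; apply: l2P => x; apply: cabs_eq0; apply/eqP.
have := l2_sum_le f [fset x]%fset.
by rewrite f0 expr0n big_seq_fset1 exprn_even_le0.
Qed.

Section Operator.
Variable T : l2 R X -> l2 R X.
Hypothesis T_bounded : bounded_operator T.

Lemma opD f g : T (f + g) = T f + T g.
Proof. by rewrite -[f in LHS]scale1r T_bounded.1 scale1r. Qed.

Lemma op0 : T 0 = 0.
Proof. by apply: (addrI (T 0)); rewrite -opD !addr0. Qed.

Lemma opZ a f : T (a *: f) = a *: T f.
Proof. by rewrite -[_ *: f]addr0 T_bounded.1 op0 addr0. Qed.

Lemma opB f g : T (f - g) = T f - T g.
Proof. by rewrite opD -scaleN1r opZ scaleN1r. Qed.

Lemma op_sum (I : Type) (s : seq I) (F : I -> l2 R X) :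
  T (\sum_(i <- s) F i) = \sum_(i <- s) T (F i).
Proof. by elim: s => [|i s IH]; rewrite ?big_nil ?op0 // !big_cons opD IH. Qed.

Lemma opnorm_le t f : (opnorm T <= t%:E)%E -> l2norm (T f) <= t * l2norm f.
Proof.
move=> Tt; have [f0|f0] := eqVneq (l2norm f) 0.
  by rewrite f0 mulr0 (l2norm_eq0 f0) op0 -[0 in leLHS](scale0r 0) l2normZ cabs0 mul0r.
have fp : 0 < l2norm f by rewrite lt_def f0 l2norm_ge0.
have cE : cabs ((l2norm f)^-1)%:C%C = (l2norm f)^-1.
  by rewrite cabs_norm ger0_norm // invr_ge0 ltW.
have : ((l2norm (T ((l2norm f)^-1%:C%C *: f)))%:E <= t%:E)%E.
  apply: le_trans Tt; apply: ereal_sup_ubound; exists ((l2norm f)^-1%:C%C *: f) => //=.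
  by rewrite l2normZ cE mulVf.
by rewrite lee_fin opZ l2normZ cE ler_pdivrMl // mulrC.
Qed.

Lemma opnorm_fin : exists2 t, 0 <= t & (opnorm T <= t%:E)%E.
Proof.
exists (Num.max 0 (fine (opnorm T))); first by rewrite le_max lexx.
have := T_bounded.2; case: (opnorm T) => [t _| |] //=; last by rewrite leNye.
by rewrite lee_fin le_max lexx orbT.
Qed.

End Operator.

End Inner.

(** * Trace class operators *)

Section TraceClass.
Variables (R : realType) (X : choiceType).
Implicit Types (f g : l2 R X).

(** The diagonal values of the form are real; taking them at [f + g] and at [f + 'i *: g] makes the
    form Hermitian. *)
Lemma positive_sym (P : l2 R X -> l2 R X) f g : positive_operator P ->
  inner (P g) f = (inner (P f) g)^*.
Proof.
move=> [Pb Ppos]; pose q f g := inner (P f) g.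
have qDl u v w : q (u + v) w = q u w + q v w.
  by rewrite /q (opD Pb) (psdDl (@inner_lin R X)).
have qDr u v w : q w (u + v) = q w u + q w v.
  by rewrite /q (psdDr (@inner_lin R X) (@inner_sym R X)).
have qZl a u w : q (a *: u) w = a * q u w.
  by rewrite /q (opZ Pb) (psdZl (@inner_lin R X)).
have qZr a u w : q w (a *: u) = a^* * q w u.
  by rewrite /q (psdZr (@inner_lin R X) (@inner_sym R X)).
have qr u : (q u u)^* = q u u by apply/CrealP/ger0_real/Ppos.
have E1 u v : (q u v)^* + (q v u)^* = q u v + q v u.
  have := qr (u + v); rewrite qDl !qDr 3!(rmorphD Num.conj) /= (qr u) (qr v).
  by move=> /eqP; rewrite -subr_eq0 => /eqP h; apply/eqP; rewrite -subr_eq0 -h; apply/eqP; ring.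
have := E1 f ('i *: g); rewrite qZl qZr !rmorphM /= conjCK conjCi.
move: (E1 f g); rewrite -/(q f g) -/(q g f).
move: (q f g) (q g f) (q f g)^* (q g f)^* => a b a' b' h1 h2.
have {}h2 : a' - b' = b - a.
  apply: (mulfI (@neq0Ci _)); apply/eqP; rewrite -subr_eq0; apply/eqP.
  by transitivity (('i * a' + - 'i * b') - (- 'i * a + 'i * b)); [ring|rewrite h2 subrr].
apply: (@mulfI _ 2); first by rewrite pnatr_eq0.
by transitivity (a + b + (b - a)); [ring|rewrite -h1 -h2; ring].
Qed.

(** With [S] the adjoint of [T], [<Tf, Tf> = <f, STf> = <f, PPf> = <Pf, Pf>]. *)
Lemma is_abs_norm (T P : l2 R X -> l2 R X) f : is_abs T P ->
  l2norm (T f) = l2norm (P f).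
Proof.
move=> [Ppos [S [TS PS]]].
apply/eqP; rewrite -(@eqrXn2 _ 2) ?l2norm_ge0 //; apply/eqP/complexI.
rewrite -!inner_ff TS -[S (T f)]/((S \o T) f) -PS /=.
by rewrite inner_sym -(positive_sym _ _ Ppos).
Qed.

(** A finite sum that is exact on [n] vectors at a time, with a bound independent of [n], takes the
    place of a convergent series. *)
Lemma trace_class_factor (T : l2 R X -> l2 R X) : trace_class T ->
  exists2 t : R, trace_norm T = t%:E & forall (e : nat -> l2 R X) n,
    exists a b : nat -> l2 R X,
    [/\ forall i, (i < n)%N -> T (e i) = \sum_(k < n) inner (e i) (a k) *: b k,
        \sum_(k < n) l2norm (a k) ^+ 2 <= t & \sum_(k < n) l2norm (b k) ^+ 2 <= t].
Proof.
(* Finiteness rules out the default [+oo], so the trace norm is the trace of an absolute value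
   [P]. *)
move=> [Tb]; rewrite /trace_norm; case: xgetP => [_ -> [P PT <-]|_]; last by rewrite ltxx.
have [Ppos _] := PT; have [Pb P0] := Ppos.
have tr0 x : 0 <= complex.Re (entry P x x).
  by rewrite -lecR /entry RRe_real ?P0 ?ger0_real ?P0.
have : (0 <= trace P)%E by apply: esum_ge0 => x _; rewrite lee_fin tr0.
case Pt : (trace P) => [t| |] // t0 _; exists t => // e n.
pose Q f g := inner (P f) g.
have Q_lin a f g h : Q (a *: f + g) h = a * Q f h + Q g h.
  by rewrite /Q Pb.1 inner_lin.
have Q_sym f g : Q g f = (Q f g)^* by apply: positive_sym.
have [g [go gr]] := gram_schmidt Q_lin Q_sym P0 e n.
(* By Cauchy-Schwarz a null [f] has [<Pf, Pf> = Q f (P f) = 0], and [T f] has the norm of [P f]. *)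
have Pnull f : Q f f = 0 -> T f = 0.
  move=> f0; apply: l2norm_eq0; rewrite (is_abs_norm f PT).
  apply/eqP; rewrite -sqrf_eq0; apply/eqP/complexI; rewrite -inner_ff.
  exact: (psd_null Q_lin Q_sym P0).
(* Bessel's inequality at [delta R x] bounds the squared [x]-coordinates of the [P (g k)] by the
   diagonal entry of [P]; summing over [x] gives the trace. *)
have le_t : \sum_(k < n) l2norm (P (g k)) ^+ 2 <= t.
  rewrite -lee_fin -Pt -sumEFin.
  rewrite (eq_bigr (fun k : 'I_n => sqsum (P (g k)))); last by move=> k _; rewrite sqsumE.
  rewrite /sqsum -esum_sum; last by move=> x k _ _; rewrite lee_fin sqr_ge0.
  apply: le_esum => x _; rewrite sumEFin lee_fin -lecR rmorph_sum /=.
  have := bessel Q_lin Q_sym P0 (delta R x) go.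
  rewrite /entry RRe_real ?ger0_real ?P0 //; apply: le_trans.
  apply: ler_sum => k _; rewrite rmorphXn /= cabsC -inner_delta.
  by rewrite -/(Q _ _) Q_sym norm_conjC.
exists (P \o g), (T \o g); split => [i iLn|//|]; last first.
  by rewrite (eq_bigr (fun k : 'I_n => l2norm (P (g k)) ^+ 2)) // => k _ /=;
     rewrite (is_abs_norm _ PT).
have := Pnull _ (gr _ iLn); rewrite /residue (opB Tb) (op_sum Tb).
move=> /eqP; rewrite subr_eq0 => /eqP ->; apply: eq_bigr => k _.
by rewrite (opZ Tb) /= [inner (e i) _]inner_sym -Q_sym.
Qed.

End TraceClass.

(** * Finite sections of Schur multipliers *)

Section FiniteNorm.
Variable R : realType.

Definition nrm (I : Type) (s : seq I) (u : I -> R[i]) : R :=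
  Num.sqrt (\sum_(i <- s) cabs (u i) ^+ 2).

Lemma nrm_ge0 I (s : seq I) u : 0 <= nrm s u. Proof. exact: sqrtr_ge0. Qed.

Lemma sqr_nrm I (s : seq I) u : nrm s u ^+ 2 = \sum_(i <- s) cabs (u i) ^+ 2.
Proof. by rewrite sqr_sqrtr // sumr_ge0 // => i _; rewrite sqr_ge0. Qed.

Lemma nrm_CS I (s : seq I) (u v : I -> R[i]) :
  cabs (\sum_(i <- s) u i * (v i)^*) <= nrm s u * nrm s v.
Proof.
pose Q (f g : I -> R[i]^o) : R[i] := \sum_(i <- s) f i * (g i)^*.
have Q_lin a f g h : Q (a *: f + g) h = a * Q f h + Q g h.
  rewrite /Q mulr_sumr -big_split; apply: eq_bigr => i _.
  by rewrite [RHS]/= mulrA -mulrDl.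
have Q_sym f g : Q g f = (Q f g)^*.
  by rewrite /Q rmorph_sum; apply: eq_bigr => i _; rewrite /= rmorphM /= conjCK mulrC.
have QE f : Q f f = (nrm s f ^+ 2)%:C%C.
  by rewrite sqr_nrm rmorph_sum; apply: eq_bigr => i _; rewrite /= -cabs2.
have Q_pos f : 0 <= Q f f by rewrite QE ler0c sqr_ge0.
have := psd_CS Q_lin Q_sym Q_pos u v.
rewrite !QE -cabsC -rmorphXn -rmorphM /= lecR -exprMn.
by rewrite ler_pXn2r // nnegrE ?cabs_ge0 // mulr_ge0 ?nrm_ge0.
Qed.

Lemma real_CS I (s : seq I) (p q : I -> R) : (forall i, 0 <= p i) -> (forall i, 0 <= q i) ->
  \sum_(i <- s) p i * q i <=
  Num.sqrt (\sum_(i <- s) p i ^+ 2) * Num.sqrt (\sum_(i <- s) q i ^+ 2).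
Proof.
move=> p0 q0; have := nrm_CS s (fun i => (p i)%:C%C) (fun i => (q i)%:C%C).
have nE (r : I -> R) : (forall i, 0 <= r i) ->
    nrm s (fun i => (r i)%:C%C) = Num.sqrt (\sum_(i <- s) r i ^+ 2).
  by move=> r0; congr Num.sqrt; apply: eq_bigr => i _; rewrite cabsr.
rewrite !nE // (_ : \sum_(i <- s) _ = (\sum_(i <- s) p i * q i)%:C%C).
  by rewrite cabsr // sumr_ge0 // => i _; rewrite mulr_ge0.
rewrite rmorph_sum; apply: eq_bigr => i _.
by rewrite /= rmorphM /= (CrealP _) // ger0_real // ler0c.
Qed.

Lemma le_lin_eps (a b c : R) : (forall eps, 0 < eps -> a <= b + c * eps) -> a <= b.
Proof.
move=> h; rewrite -subr_le0; apply/ler_addgt0Pl => eps e0; rewrite addr0.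
have c1 : 0 < `|c| + 1 by rewrite ltr_pwDr.
rewrite lerBlDl; apply: le_trans (h (eps / (`|c| + 1)) (divr_gt0 e0 c1)) _.
rewrite lerD2l mulrCA -[leRHS]mulr1 (ler_pM2l e0) ler_pdivrMr // mul1r.
by rewrite (le_trans (ler_norm c)) // lerDl.
Qed.

End FiniteNorm.

Section FiniteBound.
Variables (R : realType) (X : choiceType).
Implicit Types (k : X -> X -> R[i]) (F G A : {fset X}).

Definition fin_form k F G (u v : X -> R[i]) : R[i] :=
  \sum_(x <- F) \sum_(y <- G) k x y * u y * (v x)^*.

(** The block of the matrix on [F] and [G] has operator norm at most [c]; bounds uniform in [F] and
    [G] stand in for the norm of an operator not yet constructed. *)
Definition fin_bounded k F G (c : R) :=
  forall u v, cabs (fin_form k F G u v) <= c * nrm G u * nrm F v.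

Lemma fin_bounded_add k k' F G c c' : fin_bounded k F G c -> fin_bounded k' F G c' ->
  fin_bounded (fun x y => k x y + k' x y) F G (c + c').
Proof.
move=> kc kc' u v.
have -> : fin_form (fun x y => k x y + k' x y) F G u v =
    fin_form k F G u v + fin_form k' F G u v.
  rewrite /fin_form -big_split; apply: eq_bigr => x _ /=.
  by rewrite -big_split; apply: eq_bigr => y _ /=; ring.
by rewrite (le_trans (cabsD _ _)) // !mulrDl lerD.
Qed.

(** On a finite block, entrywise approximation controls the form, the error being [eps] times a sum
    fixed by [u] and [v]. *)
Lemma fin_bounded_approx k F G c :
  (forall eps, 0 < eps -> exists2 k', fin_bounded k' F G c &
     forall x y, x \in F -> y \in G -> cabs (k x y - k' x y) <= eps) ->
  fin_bounded k F G c.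
Proof.
move=> h u v; apply: (@le_lin_eps _ _ _
  (\sum_(x <- F) \sum_(y <- G) cabs (u y) * cabs (v x))) => eps e0.
have [k' k'c kk'] := h eps e0.
have -> : fin_form k F G u v = fin_form k' F G u v +
    fin_form (fun x y => k x y - k' x y) F G u v.
  rewrite /fin_form -big_split; apply: eq_bigr => x _ /=.
  by rewrite -big_split; apply: eq_bigr => y _ /=; ring.
rewrite (le_trans (cabsD _ _)) // lerD //.
rewrite (le_trans (cabs_sum _ _)) // mulr_suml big_seq [leRHS]big_seq.
apply: ler_sum => x xF; rewrite (le_trans (cabs_sum _ _)) // mulr_suml.
rewrite big_seq [leRHS]big_seq; apply: ler_sum => y yG.
by rewrite !cabsM cabsJ -mulrA mulrC ler_wpM2l ?mulr_ge0 ?cabs_ge0 ?kk'.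
Qed.

Lemma fin_bounded_eq k k' F G c :
  {in F & G, forall x y, k x y = k' x y} -> fin_bounded k' F G c -> fin_bounded k F G c.
Proof.
move=> kk' kc; apply: fin_bounded_approx => eps e0; exists k' => // x y xF yG.
by rewrite kk' // subrr cabs0 ltW.
Qed.

(** Multiplying on both sides by diagonal unitaries: [s] is absorbed in [u] and [v] without changing
    their norms. *)
Lemma fin_bounded_twist k F G c z (s : X -> R[i]) :
  (forall x, cabs (s x) = 1) -> fin_bounded k F G c ->
  fin_bounded (fun x y => z * (s x * s y) * k x y) F G (cabs z * c).
Proof.
move=> s1 kc u v.
have -> : fin_form (fun x y => z * (s x * s y) * k x y) F G u v =
    z * fin_form k F G (fun y => s y * u y) (fun x => (s x)^* * v x).
  rewrite /fin_form mulr_sumr; apply: eq_bigr => x _.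
  rewrite mulr_sumr; apply: eq_bigr => y _.
  by rewrite rmorphM /= conjCK; ring.
rewrite cabsM -!mulrA ler_wpM2l ?cabs_ge0 // mulrA; apply: le_trans (kc _ _) _.
by rewrite /nrm; under eq_bigr do rewrite cabsM s1 mul1r;
   under [X in _ * Num.sqrt X]eq_bigr do rewrite cabsM cabsJ s1 mul1r.
Qed.

Section Operator.
Variables (T : l2 R X -> l2 R X) (t : R).
Hypotheses (T_bounded : bounded_operator T) (T_le : (opnorm T <= t%:E)%E).

Lemma trunc_val (u : X -> R[i]) A x :
  (\sum_(y <- A) u y *: delta R y : l2 R X) x = if x \in A then u x else 0.
Proof.
rewrite l2val_sum (eq_bigr (fun y => u y * (x == y)%:R)) //.
case: ifP => xA; last first.
  rewrite big_seq big1 // => y yA; case: eqP yA => [<-|]; first by rewrite xA.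
  by rewrite mulr0.
rewrite (bigD1_seq x) //= eqxx mulr1 big1 ?addr0 // => y.
by rewrite eq_sym => /negbTE ->; rewrite mulr0.
Qed.

Lemma trunc_norm (u : X -> R[i]) A :
  l2norm (\sum_(y <- A) u y *: delta R y : l2 R X) <= nrm A u.
Proof.
apply: l2norm_le; first exact: nrm_ge0.
move=> B; rewrite sqr_nrm.
rewrite (eq_bigr (fun x => if x \in A then cabs (u x) ^+ 2 else 0)); last first.
  by move=> x _; rewrite trunc_val; case: ifP; rewrite // cabs0 expr0n.
apply: le_trans (_ : \sum_(x <- (A `|` B)%fset) (if x \in A then cabs (u x) ^+ 2 else 0) <= _).
  by apply: le_fset_sum (fsubsetUr _ _) => x; case: ifP; rewrite // sqr_ge0.
rewrite -big_mkcond -big_filter.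
rewrite (perm_big (enum_fset A)) //; apply: uniq_perm; rewrite ?filter_uniq ?fset_uniq // => x.
by rewrite mem_filter inE; case: (x \in A).
Qed.

Lemma trunc_op (u : X -> R[i]) A x :
  T (\sum_(y <- A) u y *: delta R y) x = \sum_(y <- A) entry T x y * u y.
Proof.
rewrite (op_sum T_bounded) l2val_sum; apply: eq_bigr => y _.
by rewrite (opZ T_bounded) l2val_Z entryE mulrC.
Qed.

Lemma entry_fin_bounded F G : 0 <= t -> fin_bounded (entry T) F G t.
Proof.
move=> t0 u v; pose w : l2 R X := \sum_(y <- G) u y *: delta R y.
have -> : fin_form (entry T) F G u v = \sum_(x <- F) (T w x) * (v x)^*.
  by apply: eq_bigr => x _; rewrite trunc_op mulr_suml.
apply: le_trans (nrm_CS _ _ _) _; rewrite ler_wpM2r ?nrm_ge0 //.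
apply: (@le_trans _ _ (l2norm (T w))).
  rewrite -(@ler_pXn2r _ 2) ?nnegrE ?nrm_ge0 ?l2norm_ge0 // sqr_nrm.
  exact: l2_sum_le.
by apply: le_trans (opnorm_le T_bounded _ T_le) _; rewrite ler_wpM2l ?trunc_norm.
Qed.

(** The easy half of Grothendieck's description of Schur multipliers: the factors [a i] and [b i]
    move into the test vectors, and Cauchy-Schwarz is applied over [i]. *)
Lemma gram_fin_bounded (I : Type) (s : seq I) (a b : I -> X -> R[i]) (m : R) F G :
  0 <= t -> 0 <= m ->
  (forall x, x \in F -> \sum_(i <- s) cabs (a i x) ^+ 2 <= m) ->
  (forall y, y \in G -> \sum_(i <- s) cabs (b i y) ^+ 2 <= m) ->
  fin_bounded (fun x y => (\sum_(i <- s) a i x * b i y) * entry T x y) F G (m * t).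
Proof.
move=> t0 m0 am bm u v.
have -> : fin_form (fun x y => (\sum_(i <- s) a i x * b i y) * entry T x y) F G u v =
    \sum_(i <- s) fin_form (entry T) F G (fun y => b i y * u y) (fun x => (a i x)^* * v x).
  rewrite /fin_form [RHS]exchange_big; apply: eq_bigr => x _ /=.
  rewrite [RHS]exchange_big; apply: eq_bigr => y _ /=.
  rewrite !mulr_suml; apply: eq_bigr => i _.
  by rewrite rmorphM /= conjCK; ring.
apply: le_trans (cabs_sum _ _) _.
apply: le_trans (ler_sum _ (fun i _ => entry_fin_bounded F G t0 _ _)) _.
under eq_bigr do rewrite -mulrA.
rewrite -mulr_sumr [m * t]mulrC -!mulrA ler_wpM2l //.
apply: le_trans (real_CS _ _ _) _ => [i|i|]; try exact: nrm_ge0.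
have side A (c : I -> X -> R[i]) (w : X -> R[i]) :
    (forall y, y \in A -> \sum_(i <- s) cabs (c i y) ^+ 2 <= m) ->
    Num.sqrt (\sum_(i <- s) nrm A (fun y => c i y * w y) ^+ 2) <= Num.sqrt m * nrm A w.
  move=> cm; rewrite -sqrtrM // ler_wsqrtr //.
  under eq_bigr do rewrite sqr_nrm.
  rewrite exchange_big /= mulr_sumr big_seq [leRHS]big_seq; apply: ler_sum => y yA.
  under eq_bigr do rewrite cabsM exprMn.
  by rewrite -mulr_suml ler_wpM2r ?sqr_ge0 ?cm.
rewrite -[m in leRHS]sqr_sqrtr // expr2 mulrACA -!mulrA mulrA.
rewrite [X in _ <= X](_ : _ = Num.sqrt m * nrm G u * (Num.sqrt m * nrm F v)); last by ring.
rewrite ler_pM ?sqrtr_ge0 ?side // => y yF.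
rewrite (eq_bigr (fun i => cabs (a i y) ^+ 2)) ?am //.
by move=> i _; rewrite cabsJ.
Qed.

End Operator.

End FiniteBound.

(** * From finite blocks to Schur multipliers *)

Section SchurCriterion.
Variables (R : realType) (X : choiceType).
Implicit Types (k phi : X -> X -> R[i]) (f : l2 R X) (F G A : {fset X}).

Lemma l2_point_le f x : cabs (f x) <= l2norm f.
Proof.
rewrite -(@ler_pXn2r _ 2) ?nnegrE ?cabs_ge0 ?l2norm_ge0 //.
by have := l2_sum_le f [fset x]%fset; rewrite big_seq_fset1.
Qed.

Lemma trunc_approx f (eps : R) : 0 < eps -> exists A0, forall A, (A0 `<=` A)%fset ->
  l2norm (f - \sum_(y <- A) f y *: delta R y) <= eps.
Proof.
move=> e0; have [A0 A0P] := l2_sum_approx f (exprn_gt0 2 e0).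
exists A0 => A /A0P fA; apply: l2norm_le (ltW e0) _ => B.
pose r x : R := if x \in A then 0 else cabs (f x) ^+ 2.
pose s x : R := if x \in A then cabs (f x) ^+ 2 else 0.
have r0 x : 0 <= r x by rewrite /r; case: ifP; rewrite // sqr_ge0.
have s0 x : 0 <= s x by rewrite /s; case: ifP; rewrite // sqr_ge0.
rewrite (eq_bigr r) => [|x _]; last first.
  rewrite (_ : (f - _) x = f x - (\sum_(y <- A) f y *: delta R y : l2 R X) x) //.
  by rewrite trunc_val /r; case: ifP; rewrite ?subrr ?cabs0 ?expr0n // subr0.
apply: le_trans (le_fset_sum r0 (fsubsetUr A B)) _.
have := l2_sum_le f (A `|` B)%fset.
rewrite (eq_bigr (fun x => r x + s x)) => [|x _]; last first.
  by rewrite /r /s; case: ifP; rewrite ?add0r ?addr0.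
rewrite big_split /=; have := le_fset_sum s0 (fsubsetUl A B).
rewrite big_seq (eq_bigr (fun x => cabs (f x) ^+ 2)) -?big_seq => [|x xA]; last first.
  by rewrite /s xA.
move: fA; rewrite lerBlDr; lra.
Qed.

(** Testing the block against [f] and [g] themselves yields [||g||^2 <= c ||f|| ||g||] on [F], up to
    [eps]. *)
Lemma matrix_image_le k (c : R) f (g : X -> R[i]) : 0 <= c ->
  (forall F G, fin_bounded k F G c) ->
  (forall x eps, 0 < eps -> exists A0, forall A, (A0 `<=` A)%fset ->
     cabs (\sum_(y <- A) k x y * f y - g x) <= eps) ->
  forall F, \sum_(x <- F) cabs (g x) ^+ 2 <= (c * l2norm f) ^+ 2.
Proof.
move=> c0 kc kfg F; rewrite -sqr_nrm.
suff : nrm F g ^+ 2 <= c * l2norm f * nrm F g.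
  have [->|g0] := eqVneq (nrm F g) 0; first by rewrite expr0n sqr_ge0.
  have gp : 0 < nrm F g by rewrite lt_def g0 nrm_ge0.
  rewrite {1}expr2 ler_pM2r // => h.
  by rewrite ler_pXn2r // nnegrE ?nrm_ge0 // mulr_ge0 ?l2norm_ge0.
apply: (@le_lin_eps _ _ _ (\sum_(x <- F) cabs (g x))) => eps e0.
have [A0 A0P] : {A0 : X -> {fset X} & forall x A, (A0 x `<=` A)%fset ->
    cabs (\sum_(y <- A) k x y * f y - g x) <= eps}.
  by apply: (@choice _ _ (fun x A0 => forall A, (A0 `<=` A)%fset -> _ <= eps)) => x; apply: kfg.
(* One finite set of columns serves all rows in [F]. *)
set A := (\bigcup_(x <- F) A0 x)%fset.
have AP x : x \in F -> cabs (\sum_(y <- A) k x y * f y - g x) <= eps.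
  by move=> xF; apply/A0P/bigfcup_sup.
have fA : nrm A f <= l2norm f.
  by rewrite -(@ler_pXn2r _ 2) ?nnegrE ?nrm_ge0 ?l2norm_ge0 // sqr_nrm l2_sum_le.
have E : (nrm F g ^+ 2)%:C%C = fin_form k F A f g -
    \sum_(x <- F) (\sum_(y <- A) k x y * f y - g x) * (g x)^*.
  rewrite sqr_nrm rmorph_sum /= -sumrB; apply: eq_bigr => x _.
  by rewrite cabs2 -mulr_suml mulrBl opprB addrC addrNK.
rewrite -[leLHS]ger0_norm ?sqr_ge0 // -cabs_norm E (le_trans (cabsD _ _)) //.
rewrite cabsN lerD //.
  apply: le_trans (kc _ _ _ _) _; rewrite ler_wpM2r ?nrm_ge0 //.
  by rewrite ler_wpM2l.
apply: le_trans (cabs_sum _ _) _; rewrite mulr_suml big_seq [leRHS]big_seq.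
apply: ler_sum => x xF; rewrite cabsM cabsJ mulrC ler_wpM2l ?cabs_ge0 //.
exact: AP.
Qed.

Lemma matrix_operator k (c : R) : 0 <= c -> (forall F G, fin_bounded k F G c) ->
  exists S : l2 R X -> l2 R X, bounded_operator S /\ forall x y, entry S x y = k x y.
Proof.
move=> c0 kc.
(* A one-row block tested on its own conjugate bounds the row by [c]; the operator can then be
   defined by inner products with rows. *)
have row_l2 x : (fun y => (k x y)^* : R[i]^o) \in @is_l2 R X.
  apply: (@is_l2_le _ _ _ (c ^+ 2)) => G.
  have := kc [fset x]%fset G (fun y => (k x y)^*) (fun=> 1).
  rewrite /fin_form /nrm !big_seq_fset1 conjC1 -[cabs 1]/(cabs 1%:C%C) cabs_norm normr1.
  rewrite expr1n sqrtr1 mulr1.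
  set s := \sum_(y <- G) cabs (k x y) ^+ 2.
  have s0 : 0 <= s by rewrite sumr_ge0 // => y _; rewrite sqr_ge0.
  have sJ : \sum_(y <- G) cabs (k x y)^* ^+ 2 = s.
    by apply: eq_bigr => y _; rewrite cabsJ.
  rewrite sJ (_ : \sum_(y <- G) _ = s%:C%C); last first.
    by rewrite rmorph_sum; apply: eq_bigr => y _; rewrite /= cabs2 mulr1.
  rewrite cabsr //; have [->|s1] := eqVneq s 0; first by rewrite sqr_ge0.
  have sp : 0 < Num.sqrt s by rewrite sqrtr_gt0 lt_def s1.
  rewrite -{1}[s]sqr_sqrtr // expr2 ler_pM2r // => h.
  by rewrite -[s]sqr_sqrtr // ler_pXn2r // nnegrE ltW.
pose row x : l2 R X := L2 (row_l2 x).
pose S0 f : X -> R[i]^o := fun x => inner f (row x).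
have S0le f A : \sum_(x <- A) cabs (S0 f x) ^+ 2 <= (c * l2norm f) ^+ 2.
  apply: (matrix_image_le c0 kc) => x eps /(inner_approx f (row x))[A0 A0P].
  exists A0 => B /A0P; congr (cabs (_ - _) <= eps).
  by apply: eq_bigr => y _; rewrite /= conjCK mulrC.
pose S f : l2 R X := L2 (is_l2_le (S0le f)).
exists S; split; [split|].
- by move=> a f g; apply: l2P => x; apply: inner_lin.
- apply: le_lt_trans (ltry c); apply: ge_ereal_sup => _ [f /= f1 <-].
  rewrite lee_fin; apply: (@le_trans _ _ (c * l2norm f)).
    by apply: l2norm_le; [rewrite mulr_ge0 ?l2norm_ge0|exact: S0le].
  by rewrite ler_piMr.
- by move=> x y; rewrite entryE /= /S0 inner_sym inner_delta /= conjCK.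
Qed.

(** As [S] is bounded, [S f] is the limit of the images of truncations of [f], so [matrix_image_le]
    applies. *)
Lemma matrix_opnorm_le (S : l2 R X -> l2 R X) (c : R) : bounded_operator S -> 0 <= c ->
  (forall F G, fin_bounded (entry S) F G c) -> (opnorm S <= c%:E)%E.
Proof.
move=> Sb c0 Sc; apply: ge_ereal_sup => _ [f /= f1 <-]; rewrite lee_fin.
apply: (@le_trans _ _ (c * l2norm f)); last by rewrite ler_piMr.
apply: l2norm_le; first by rewrite mulr_ge0 ?l2norm_ge0.
apply: (matrix_image_le c0 Sc) => x eps e0.
have [t t0 St] := opnorm_fin Sb.
have t1 : 0 < t + 1 by rewrite ltr_wpDl.
have [A0 A0P] := trunc_approx f (divr_gt0 e0 t1).
exists A0 => A /A0P fA; rewrite -(trunc_op Sb) -cabsN opprB.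
set g := \sum_(y <- A) _; rewrite -[_ - _]/((S f - S g) x) -(opB Sb).
apply: le_trans (l2_point_le _ _) _; apply: le_trans (opnorm_le Sb _ St) _.
apply: le_trans (_ : (t + 1) * (eps / (t + 1)) <= _).
  by apply: ler_pM; rewrite ?l2norm_ge0 ?lerDl.
by rewrite mulrC divfK // gt_eqF.
Qed.

Lemma schur_criterion phi (c : R) : 0 <= c ->
  (forall (T : l2 R X -> l2 R X) (t : R), bounded_operator T -> 0 <= t ->
     (opnorm T <= t%:E)%E -> forall F G,
     fin_bounded (fun x y => phi x y * entry T x y) F G (c * t)) ->
  schur_multiplier phi /\ (cb_norm phi <= c%:E)%E.
Proof.
move=> c0 phic; have le_c : (cb_norm phi <= c%:E)%E.
  apply: ge_ereal_sup => _ [S [Sb [T [Tb T1 ST]]] <-].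
  apply: (matrix_opnorm_le Sb c0) => F G u v.
  have := phic T 1 Tb ler01 T1 F G u v; rewrite mulr1.
  congr (cabs _ <= _); apply: eq_bigr => x _; apply: eq_bigr => y _.
  by rewrite ST.
split=> //; split=> [T Tb|]; last exact: le_lt_trans le_c (ltry c).
have [t t0 Tt] := opnorm_fin Tb.
have [S [Sb SE]] := matrix_operator (mulr_ge0 c0 t0) (phic T t Tb t0 Tt).
by exists S.
Qed.

End SchurCriterion.

(** * Hankel matrices *)

Section Sequences.
Variable R : realType.

(** With [S] the accumulated variation, [u] is the difference of the bounded nondecreasing sequences
    [u + S] and [S]. *)
Let variation_cvg_real (u : nat -> R) (t : R) :
  (forall n, \sum_(i < n) `|u i - u i.+1| <= t) -> cvgn u.
Proof.
move=> ut; pose S n := \sum_(i < n) `|u i - u i.+1|.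
have SS n : S n.+1 = S n + `|u n - u n.+1| by rewrite /S big_ord_recr.
have cS : cvgn S.
  apply: nondecreasing_is_cvgn; last by exists t => _ [n _ <-]; apply: ut.
  by apply/nondecreasing_seqP => n; rewrite SS lerDl.
have cuS : cvgn (fun n => u n + S n).
  apply: nondecreasing_is_cvgn.
    apply/nondecreasing_seqP => n; rewrite SS.
    by have := ler_norm (u n - u n.+1); lra.
  exists (u 0%N + t + t) => _ [n _ <-]; apply: lerD (ut n).
  apply: le_trans (_ : u 0%N + S n <= _); last by rewrite lerD2l; apply: ut.
  elim: n => [|n IH]; first by rewrite /S big_ord0 addr0.
  rewrite SS; have := ler_norm (- (u n - u n.+1)); rewrite normrN; lra.
rewrite (_ : u = (fun n => u n + S n) - S); first exact: is_cvgB.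
by apply/funext => n /=; rewrite -[RHS]/(u n + S n - S n) addrK.
Qed.

Lemma variation_cvg (u : nat -> R[i]) (t : R) :
  (forall n, \sum_(i < n) cabs (u i - u i.+1) <= t) ->
  exists l, forall eps, 0 < eps ->
    exists n0, forall n, (n0 <= n)%N -> cabs (u n - l) <= eps.
Proof.
move=> ut.
have cRe : cvgn (fun n => complex.Re (u n)).
  apply: (variation_cvg_real (t := t)) => n; apply: le_trans (ut n).
  apply: ler_sum => i _; rewrite -lecR cabsC.
  by rewrite -raddfB; apply: normc_ge_Re.
have cIm : cvgn (fun n => complex.Im (u n)).
  apply: (variation_cvg_real (t := t)) => n; apply: le_trans (ut n).
  apply: ler_sum => i _; rewrite -raddfB /cabs.
  case: (u i - u i.+1) => a b /=; rewrite -sqrtr_sqr ler_wsqrtr //.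
  by rewrite lerDr sqr_ge0.
exists (complex.Complex (limn (fun n => complex.Re (u n))) (limn (fun n => complex.Im (u n)))).
move=> eps e0; have e2 : 0 < eps / 2 by rewrite divr_gt0.
have /cvgrPdist_le/(_ _ e2) [n1 _ N1] := cRe.
have /cvgrPdist_le/(_ _ e2) [n2 _ N2] := cIm.
exists (maxn n1 n2) => n; rewrite geq_max => /andP[/N1 /= h1 /N2 /= h2].
rewrite distrC in h1; rewrite distrC in h2.
move: h1 h2; set a := limn _; set b := limn _.
case: (u n) => x y h1 h2; rewrite /= in h1 h2.
rewrite [X in cabs X](_ : _ = (x - a)%:C%C + 'i * (y - b)%:C%C); last first.
  by rewrite [LHS]complexE complexiE.
have ci : cabs ('i : R[i]) = 1 by apply: complexI; rewrite cabsC normCi.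
rewrite (le_trans (cabsD _ _)) // cabsM ci mul1r !cabs_norm.
by rewrite [leRHS]splitr lerD.
Qed.

Lemma cvg_eps (u : nat -> R[i]) (l : R[i]) :
  (forall eps : R, 0 < eps -> exists n0, forall n, (n0 <= n)%N -> cabs (u n - l) <= eps) ->
  (fun n => u n : R[i]^o) @ \oo --> (l : R[i]^o).
Proof.
move=> ul; apply/(@cvgrPdist_le R[i] (R[i]^o)) => eps e0.
have e1 : eps = (complex.Re eps)%:C%C by rewrite RRe_real // gtr0_real.
have [|n0 n0P] := ul (complex.Re eps); first by rewrite -ltcR -e1.
exists n0 => // n /= /n0P; rewrite -lecR cabsC -e1 => h.
by rewrite distrC.
Qed.

End Sequences.

Section Hankel.
Variables (R : realType) (N : nat) (phidot : nat -> R[i]).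
Variable H : l2 R nat -> l2 R nat.
Hypotheses (H_tc : trace_class H)
  (H_entry : forall i j, entry H i j = hankel N phidot i j).

Let w i : R := Num.sqrt ('C((N + i - 1)%N, (N - 1)%N))%:R.

Let w2 i : w i ^+ 2 = ('C((N + i - 1)%N, (N - 1)%N))%:R.
Proof. by rewrite sqr_sqrtr. Qed.

Let w_gt0 i : 0 < w i.
Proof. by rewrite sqrtr_gt0 ltr0n bin_gt0 leq_sub2r // leq_addr. Qed.

(* The rank-one terms of [H], divided by the weights of the Hankel matrix. *)
Lemma hankel_factor : exists t : R, [/\ 0 <= t, trace_norm H = t%:E & forall n,
  exists a b : nat -> nat -> R[i],
  [/\ forall i j, (j < n)%N -> diff2 phidot (i + j) = \sum_(l < n) a l i * b l j,
      forall D, \sum_(l < n) \sum_(i < D)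
        ('C((N + i - 1)%N, (N - 1)%N))%:R * cabs (a l i) ^+ 2 <= t &
      forall D, \sum_(l < n) \sum_(i < D)
        ('C((N + i - 1)%N, (N - 1)%N))%:R * cabs (b l i) ^+ 2 <= t]].
Proof.
have [t Ht fact] := trace_class_factor H_tc.
exists t; split => // [|n].
  have [a [b [_ + _]]] := fact (@delta R nat) 0%N.
  by rewrite big_ord0.
have [a [b [Hab at_ bt]]] := fact (@delta R nat) n.
have bound (c : nat -> l2 R nat) (c' : nat -> nat -> R[i]) D :
    (forall l i, cabs (c' l i) = cabs (c l i) / w i) ->
    \sum_(l < n) l2norm (c l) ^+ 2 <= t ->
    \sum_(l < n) \sum_(i < D)
      ('C((N + i - 1)%N, (N - 1)%N))%:R * cabs (c' l i) ^+ 2 <= t.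
  move=> cc' ct; apply: le_trans ct; apply: ler_sum => l _.
  apply: le_trans (l2_sum_le (c l) [fset i in iota 0 D]%fset).
  rewrite (perm_big (iota 0 D)) /=; last first.
    by apply: uniq_perm; rewrite ?fset_uniq ?iota_uniq // => i; rewrite !inE.
  rewrite -[X in iota 0 X]subn0 -/(index_iota 0 D) big_mkord; apply: ler_sum => i _.
  by rewrite cc' -w2 -exprMn mulrC divfK // gt_eqF.
have cdiv z i : cabs (z / (w i)%:C%C) = cabs z / w i.
  by rewrite cabsM -fmorphV cabs_norm ger0_norm // invr_ge0 ltW.
(* The conjugate arises because [inner] is antilinear in its second argument. Only the column index
   [j] needs to stay below [n], since [H] is expanded on the first [n] basis vectors. *)
exists (fun l i => b l i / (w i)%:C%C), (fun l j => (a l j)^* / (w j)%:C%C); split.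
- move=> i j jn; have := H_entry i j; rewrite entryE Hab // l2val_sum.
  have w0 m : (w m)%:C%C != 0 :> R[i] by rewrite eq_complex /= eqxx andbT gt_eqF.
  rewrite /hankel -/(w i) -/(w j) => E.
  apply: (@mulfI _ ((w i)%:C%C * (w j)%:C%C)); first by rewrite mulf_neq0.
  rewrite -E mulr_sumr; apply: eq_bigr => l _.
  rewrite l2val_Z inner_sym inner_delta.
  by field; rewrite !w0.
- by move=> D; apply: (bound _ (fun l i => b l i / (w i)%:C%C) _ _ bt) => l i; rewrite cdiv.
- by move=> D; apply: (bound _ (fun l i => (a l i)^* / (w i)%:C%C) _ _ at_) => l i;
     rewrite cdiv cabsJ.
Qed.

(** The factorisation is read at row [i + s], column [i], using [2pq <= p^2 + q^2] and weights at
    least 1. For [s] equal to 0 and 1 this bounds the variation of the even and odd subsequences of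
    [phidot]. *)
Lemma hankel_diagonal_sum s : exists t : R, forall n,
  \sum_(i < n) cabs (diff2 phidot (i + s + i)) <= t.
Proof.
have [t [t0 _ fact]] := hankel_factor; exists t => n.
have [a [b [hab at_ bt]]] := fact n.
apply: le_trans (_ : \sum_(i < n) \sum_(l < n)
    (cabs (a l (i + s)%N) ^+ 2 / 2 + cabs (b l i) ^+ 2 / 2) <= _).
  apply: ler_sum => i _; rewrite hab //; apply: le_trans (cabs_sum _ _) _.
  apply: ler_sum => l _; rewrite cabsM.
  by have := sqr_ge0 (cabs (a l (i + s)%N) - cabs (b l i)); rewrite sqrrB; lra.
have w1 i : 1 <= ('C((N + i - 1)%N, (N - 1)%N))%:R :> R.
  by rewrite ler1n bin_gt0 leq_sub2r // leq_addr.
rewrite exchange_big; under eq_bigr do rewrite big_split /= -!mulr_suml.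
rewrite big_split /= -!mulr_suml [leRHS]splitr; apply: lerD; rewrite ler_pM2r //.
  apply: le_trans (at_ (s + n)%N); apply: ler_sum => l _.
  rewrite big_split_ord /= -[leLHS]add0r; apply: lerD.
    by apply: sumr_ge0 => i _; rewrite mulr_ge0 ?sqr_ge0.
  by apply: ler_sum => i _; rewrite addnC ler_peMl ?sqr_ge0.
apply: le_trans (bt n); apply: ler_sum => l _; apply: ler_sum => i _.
by rewrite ler_peMl ?sqr_ge0.
Qed.

Lemma hankel_cvg : exists l0 l1 : R[i], forall eps : R, 0 < eps -> exists n0, forall n,
  (n0 <= n)%N -> cabs (phidot (2 * n)%N - l0) <= eps /\
                 cabs (phidot (2 * n + 1)%N - l1) <= eps.
Proof.
have [t0 t0P] := hankel_diagonal_sum 0; have [t1 t1P] := hankel_diagonal_sum 1.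
have [|l0 l0P] := @variation_cvg R (fun n => phidot (2 * n)%N) t0.
  move=> n; apply: le_trans (t0P n); apply: ler_sum => i _.
  rewrite /diff2 (_ : i + 0 + i = 2 * i)%N; last by clear; lia.
  by rewrite (_ : 2 * i.+1 = 2 * i + 2)%N //; clear; lia.
have [|l1 l1P] := @variation_cvg R (fun n => phidot (2 * n + 1)%N) t1.
  move=> n; apply: le_trans (t1P n); apply: ler_sum => i _.
  rewrite /diff2 (_ : i + 1 + i = 2 * i + 1)%N; last by clear; lia.
  by rewrite (_ : 2 * i.+1 + 1 = 2 * i + 1 + 2)%N //; clear; lia.
exists l0, l1 => eps e0; have [n0 N0] := l0P eps e0; have [n1 N1] := l1P eps e0.
exists (maxn n0 n1) => n; rewrite geq_max => /andP[/N0 h0 /N1 h1]; by split.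
Qed.

End Hankel.

(** * The radial kernel *)

Lemma bin_le_exp2 n m : ('C(n, m) <= 2 ^ n)%N.
Proof.
elim: n m => [|n IH] [|m]; rewrite ?bin0 ?expn_gt0 // binS expnS mul2n -addnn.
exact: leq_add.
Qed.

Section Multiplier.
Variables (R : realType) (K : cubeComplex) (o : K) (N : nat).
Hypotheses (K_CAT0 : CAT0 K) (K_dim : has_dimension K N) (N_ge1 : (1 <= N)%N).
Local Notation e := (skeleton1 K).
Local Notation rk := (dist e o).
Local Notation below := (below e o).
Local Notation coef := (lcover_coef K_CAT0 o K_dim R[i]).

Lemma lcover_coef_le v s : cabs (coef v s) <= 2 ^+ N.
Proof.
rewrite /lcover_coef (_ : _ * _ =
    ((-1) ^+ s * ('C((size (lcovers K_CAT0 o K_dim v)).-1, s))%:R)%:C%C).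
  rewrite cabs_norm normrM normrX normrN1 expr1n mul1r ger0_norm // -natrX ler_nat.
  apply: leq_trans (bin_le_exp2 _ _) _; rewrite leq_exp2l //.
  by apply: leq_trans (leq_pred _) _; apply: lcovers_size.
by rewrite rmorphM rmorphXn rmorphN1 rmorph_nat.
Qed.

(** The vertex count ['C(N + i - 1, i)] equals the Hankel weight at [i], which is at most the weight
    at [i + s]. *)
Lemma shift_sum_le (F : nat -> R) s D : (forall i, 0 <= F i) ->
  \sum_(i < D) ('C((N + i - 1)%N, i))%:R * F (i + s)%N <=
  \sum_(i < s + D) ('C((N + i - 1)%N, (N - 1)%N))%:R * F i.
Proof.
move=> F0; rewrite [leRHS]big_split_ord /= -[leLHS]add0r; apply: lerD.
  by apply: sumr_ge0 => i _; rewrite mulr_ge0.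
apply: ler_sum => i _; rewrite [(s + i)%N]addnC ler_wpM2r // ler_nat.
have -> : 'C((N + i - 1)%N, i) = 'C((N + i - 1)%N, (N - 1)%N).
  by rewrite -bin_sub; [congr binomial|]; move: N_ge1 (i : nat); clear; lia.
by apply: leq_bin2l; rewrite leq_sub2r // addnA leq_addr.
Qed.

Section Factors.
Variables (n : nat) (a : nat -> nat -> R[i]) (t : R).
Hypothesis a_le : forall D, \sum_(l < n) \sum_(i < D)
  ('C((N + i - 1)%N, (N - 1)%N))%:R * cabs (a l i) ^+ 2 <= t.

(** Each of the [N] values of [s] contributes at most [4 ^+ N * t], the first factor bounding the
    squared coefficients. *)
Lemma vertex_sum_le (c : K -> nat -> R[i]) (U : seq K) x : uniq U ->
  (forall v s, cabs (c v s) <= 2 ^+ N) ->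
  \sum_(v <- U) \sum_(s < N) \sum_(l < n)
    cabs ((below v x)%:R * c v s * a l (rk x - rk v + s)%N) ^+ 2 <= 4 ^+ N * N%:R * t.
Proof.
move=> uU cN.
apply: le_trans (_ : \sum_(v <- U) \sum_(s < N) \sum_(l < n)
    4 ^+ N * ((below v x)%:R * cabs (a l (rk x - rk v + s)%N) ^+ 2) <= _).
  apply: ler_sum => v _; apply: ler_sum => s _; apply: ler_sum => l _.
  rewrite !cabsM !exprMn cabs_nat.
  have -> : (below v x)%:R ^+ 2 = (below v x)%:R :> R.
    by case: (below v x); rewrite ?expr1n ?expr0n.
  rewrite [leRHS]mulrCA [leRHS]mulrA; apply: ler_wpM2r; first exact: sqr_ge0.
  apply: ler_wpM2l => //.
  have -> : 4 ^+ N = (2 ^+ N) ^+ 2 :> R.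
    by rewrite -exprM mulnC exprM; congr (_ ^+ _); rewrite expr2 -natrM.
  by apply: lerXn2r; rewrite ?nnegrE ?cabs_ge0 ?exprn_ge0.
have -> : 4 ^+ N * N%:R * t = \sum_(s < N) 4 ^+ N * t.
  by rewrite sumr_const card_ord mulrAC mulr_natr.
rewrite exchange_big /=.
apply: ler_sum => s _; rewrite exchange_big /=.
under eq_bigr do rewrite -mulr_sumr.
rewrite -mulr_sumr; apply: ler_wpM2l; first exact: exprn_ge0.
apply: le_trans (a_le (s + (rk x).+1)); apply: ler_sum => l _.
apply: le_trans (@shift_sum_le (fun i => cabs (a l i) ^+ 2) _ _ _) => [|i];
  last exact: sqr_ge0.
apply: (below_sum_le K_CAT0 K_dim (g := fun i => cabs (a l (i + s)%N) ^+ 2)) => // i.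
exact: sqr_ge0.
Qed.

(** A ray meets each depth once, so weights at least 1 suffice. *)
Lemma ray_sum_le r P :
  \sum_(k < P) \sum_(l < n) cabs (a l (r + k.+1)%N) ^+ 2 <= t.
Proof.
rewrite exchange_big; apply: le_trans (a_le (r.+1 + P)); apply: ler_sum => l _.
rewrite big_split_ord /= -[leLHS]add0r; apply: lerD.
  by apply: sumr_ge0 => i _; rewrite mulr_ge0 ?sqr_ge0.
apply: ler_sum => i _; rewrite addSnnS ler_peMl ?sqr_ge0 //.
by rewrite ler1n bin_gt0 leq_sub2r // leq_addr.
Qed.

End Factors.

Variables (phidot : nat -> R[i]) (t : R).
Hypothesis t_ge0 : 0 <= t.
Hypothesis factor : forall n, exists a b : nat -> nat -> R[i],
  [/\ forall i j, (j < n)%N -> diff2 phidot (i + j) = \sum_(l < n) a l i * b l j,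
      forall D, \sum_(l < n) \sum_(i < D)
        ('C((N + i - 1)%N, (N - 1)%N))%:R * cabs (a l i) ^+ 2 <= t &
      forall D, \sum_(l < n) \sum_(i < D)
        ('C((N + i - 1)%N, (N - 1)%N))%:R * cabs (b l i) ^+ 2 <= t].

Lemma kernel_fin_bounded (T : l2 R K -> l2 R K) (t' : R) (F G : {fset K}) P :
  bounded_operator T -> 0 <= t' -> (opnorm T <= t'%:E)%E ->
  fin_bounded (fun x y => (phidot (dist e x y) -
    phidot (rk x + rk y + (P.+1).*2)%N) * entry T x y) F G
    ((4 ^+ N * N%:R + 1) * t * t').
Proof.
move=> Tb t'0 Tt.
have [L LP] : {L : K -> seq K & forall x v, below v x -> v \in L x}.
  apply: (@choice _ _ (fun x L => forall v, below v x -> v \in L)) => x.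
  have [L [_ LE _ _]] := @below_enum _ K_CAT0 o _ K_dim x [::] isT isT.
  by exists L => v vx; rewrite LE vx.
(* A finite list containing every vertex below some point of [F], as [kernel_expand] requires. *)
pose U := undup (flatten [seq L x | x <- F]).
have UP x v : x \in F -> below v x -> v \in U.
  move=> xF vx; rewrite mem_undup; apply/flattenP; exists (L x); last exact: LP.
  exact: map_f.
pose D := (\sum_(y <- G) rk y)%N.
have rD y : y \in G -> (rk y <= D)%N.
  by move=> yG; rewrite /D (big_rem y) //= leq_addr.
(* Large enough for every column index, [rk y - rk v + s] or [rk y + k.+1], to be below [n]. *)
have [n nD] : exists n, (D + N + P.+1 <= n)%N by exists (D + N + P.+1)%N.
have [a [b [hab at_ bt]]] := factor n.
pose s1 := [seq (vs, l) | vs <- [seq (v, s) | v <- U, s <- index_enum 'I_N],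
  l <- index_enum 'I_n].
pose s2 := [seq (k, l) | k <- index_enum 'I_P, l <- index_enum 'I_n].
have s1E (F' : _ -> R) : \sum_(i <- s1) F' i =
    \sum_(v <- U) \sum_(s < N) \sum_(l < n) F' (v, s, l) by rewrite !big_allpairs.
have s2E (F' : _ -> R) : \sum_(i <- s2) F' i = \sum_(k < P) \sum_(l < n) F' (k, l).
  by rewrite !big_allpairs.
pose A1 (i : K * 'I_N * 'I_n) x : R[i] :=
  (below i.1.1 x)%:R * coef i.1.1 i.1.2 * a i.2 (rk x - rk i.1.1 + i.1.2)%N.
(* All the signed coefficients sit in [A1]; here the coefficient is 1. *)
pose B1 (i : K * 'I_N * 'I_n) y : R[i] :=
  (below i.1.1 y)%:R * 1 * b i.2 (rk y - rk i.1.1 + i.1.2)%N.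
pose A2 (i : 'I_P * 'I_n) x : R[i] := a i.2 (rk x + i.1.+1)%N.
pose B2 (i : 'I_P * 'I_n) x : R[i] := b i.2 (rk x + i.1.+1)%N.
apply: (@fin_bounded_eq _ _ _ (fun x y =>
  (\sum_(i <- s1) A1 i x * B1 i y) * entry T x y +
  (\sum_(i <- s2) A2 i x * B2 i y) * entry T x y)).
  move=> x y xF yG; rewrite -mulrDl; congr (_ * _).
  rewrite -(kernel_expand K_CAT0 (o := o) K_dim phidot (U := U) P N_ge1
    (undup_uniq _)); last first.
    by move=> v vx _; apply: UP vx.
  rewrite !big_allpairs; congr (_ + _).
    apply: eq_bigr => v _; apply: eq_bigr => s _; rewrite -/(diff2 _ _) hab.
      rewrite mulr_sumr; apply: eq_bigr => l _; rewrite /A1 /B1 /=.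
      by rewrite mulr1; ring.
    move: (rD y yG) (ltn_ord s) nD; move: (rk y) (rk v) (s : nat); clear; lia.
  apply: eq_bigr => k _; rewrite -/(diff2 _ _) hab //.
  move: (rD y yG) (ltn_ord k) nD; move: (rk y) (k : nat); clear; lia.
have m0 : 0 <= 4 ^+ N * N%:R * t by rewrite !mulr_ge0 ?exprn_ge0.
rewrite !mulrDl mul1r; apply: fin_bounded_add.
  apply: gram_fin_bounded => // x _; rewrite s1E.
    exact: (vertex_sum_le at_ x (undup_uniq _) lcover_coef_le).
  apply: (vertex_sum_le bt (c := fun _ _ => 1) x (undup_uniq _)) => _ _.
  by rewrite (cabs_nat R 1) exprn_ege1 ?ler1n.
apply: gram_fin_bounded => // x _; rewrite s2E.
  exact: (ray_sum_le at_).
exact: (ray_sum_le bt).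
Qed.

End Multiplier.

(** * Limits and the multiplier bound *)

Theorem theoremC (R : realType) (N : nat) (N_ge1 : (1 <= N)%N) :
  exists M : R, 0 < M /\
  forall (X : cubeComplex) (phi : X -> X -> R[i]) (phidot : nat -> R[i])
         (H : l2 R nat -> l2 R nat),
    CAT0 X -> has_dimension X N ->
    (forall x y, phi x y = phidot (dist (skeleton1 X) x y)) ->
    trace_class H -> (forall i j, entry H i j = hankel N phidot i j) ->
    exists l0 l1 : R[i],
      [/\ (fun n => phidot (2 * n)%N : R[i]^o) @ \oo --> (l0 : R[i]^o),
          (fun n => phidot (2 * n + 1)%N : R[i]^o) @ \oo --> (l1 : R[i]^o),
          schur_multiplier phi &
          (cb_norm phi <= M%:E * trace_norm H
             + (cabs (2^-1 * l0 + 2^-1 * l1))%:E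
             + (cabs (2^-1 * l0 - 2^-1 * l1))%:E)%E].
Proof.
have M0 : 0 < 4 ^+ N * N%:R + 1 :> R by rewrite ltr_wpDl // mulr_ge0 ?exprn_ge0.
(* The first term comes from the sum over vertices, the 1 from the ray. *)
exists (4 ^+ N * N%:R + 1); split => // X phi phidot H X_CAT0 X_dim phiE H_tc H_entry.
have [c _] := X_dim.1; pose o : X := c [ffun=> false].
have [t [t0 Ht factor]] := hankel_factor H_tc H_entry.
have [l0 [l1 lim]] := hankel_cvg H_tc H_entry.
exists l0, l1; set cp := 2^-1 * l0 + _; set cm := 2^-1 * l0 - _.
pose rk := dist (skeleton1 X) o.
(* [s x * s y] is the sign of the parity of [rk x + rk y], which selects the even or the odd
   limit. *)
pose s (x : X) : R[i] := (-1) ^+ rk x.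
have s1 x : cabs (s x) = 1.
  by apply: complexI; rewrite cabsC normrX normrN1 expr1n.
have c0 : 0 <= (4 ^+ N * N%:R + 1) * t + cabs cp + cabs cm.
  by rewrite !addr_ge0 ?cabs_ge0 // mulr_ge0 // ltW.
have [|phi_schur phi_le] := @schur_criterion R X phi _ c0; last first.
  split => //; last by rewrite Ht -EFinM -!EFinD.
    by apply: cvg_eps => eps /lim[n0 n0P]; exists n0 => n /n0P[].
  by apply: cvg_eps => eps /lim[n0 n0P]; exists n0 => n /n0P[].
move=> T t' Tb t'0 Tt F G; apply: fin_bounded_approx => eps e0.
have t1 : 0 < t' + 1 by rewrite ltr_wpDl.
have [P limP] := lim _ (divr_gt0 e0 t1).
(* The remainder [phidot (rk x + rk y + (P.+1).*2)] is replaced by its limit: [cp + cm = l0] or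
   [cp - cm = l1], according to parity. *)
exists (fun x y => (phidot (dist (skeleton1 X) x y) -
    phidot (rk x + rk y + (P.+1).*2)%N) * entry T x y +
  cp * (1 * 1) * entry T x y + cm * (s x * s y) * entry T x y).
  rewrite [(_ * t + _ + _) * t']mulrDl [(_ * t + _) * t']mulrDl.
  apply: fin_bounded_add; last first.
    exact: fin_bounded_twist s1 (entry_fin_bounded Tb Tt F G t'0).
  apply: fin_bounded_add; last first.
    exact: (fin_bounded_twist (s := fun=> 1) cp (fun=> cabs_nat R 1)
      (entry_fin_bounded Tb Tt F G t'0)).
  exact: (kernel_fin_bounded o X_CAT0 X_dim N_ge1 t0 factor F G P Tb t'0 Tt).
move=> x y _ _; rewrite phiE.
set d := phidot (dist _ x y); set m := (rk x + rk y + _)%N.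
have -> : d * entry T x y - ((d - phidot m) * entry T x y + cp * (1 * 1) * entry T x y +
    cm * (s x * s y) * entry T x y) =
  (phidot m - (cp + cm * (s x * s y))) * entry T x y by ring.
have entry_le : cabs (entry T x y) <= t' + 1.
  rewrite entryE; apply: le_trans (l2_point_le _ _) _.
  apply: le_trans (opnorm_le Tb _ Tt) _.
  suff -> : l2norm (delta R y) = 1 by rewrite mulr1 lerDl.
  apply/eqP; rewrite -(@eqrXn2 _ 2) ?l2norm_ge0 //; apply/eqP/complexI.
  by rewrite -inner_ff inner_delta /= eqxx expr1n.
rewrite cabsM -[leRHS](divfK (lt0r_neq0 t1)) ler_pM ?cabs_ge0 //.
pose q := ((rk x + rk y)./2 + P.+1)%N.
have mE : m = (2 * q + odd (rk x + rk y))%N.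
  by rewrite /m -{1}(odd_double_half (rk x + rk y)) /q; lia.
have Pq : (P <= q)%N by rewrite /q; lia.
rewrite /s -exprD -signr_odd mE.
have [L0 L1] := limP q Pq.
case: (odd _).
  by rewrite expr1 mulrN1 (_ : cp - cm = l1) // /cp /cm; field.
by rewrite expr0 mulr1 addn0 (_ : cp + cm = l0) // /cp /cm; field.
Qed.
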